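(* Let $\varphi$ be a holomorphic self-map of $\mathbb{D}$ and let $\psi$ be a holomorphic function on $\mathbb{D}$ that is not identically zero, such that $W_{\psi,\varphi}$ is a bounded operator on $H^2(\mathbb{D})$. Then $W_{\psi,\varphi}$ is algebraic with degree $\le 2$ if and only if one of the following holds: (1) $\varphi$ is a constant function; (2) $\varphi$ is the identity map and $\psi$ is a constant function; (3) there is $p\in\mathbb{D}$ such that $\varphi(z)=\alpha_p(-\alpha_p(z))$ and $$\psi\circ\alpha_p(z)=c\,\exp\Big\{\sum_{k=0}^{\infty}a_{2k+1}z^{2k+1}\Big\},\qquad z\in\mathbb{D},$$ for some complex constants $c$ and $a_{2k+1}$ ($k\ge0$), the series converging on $\mathbb{D}$ so that the right-hand side is holomorphic on $\mathbb{D}$.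
   Context: $\mathbb{D}$ is the open unit disk in $\mathbb{C}$; $H^2(\mathbb{D})$ is the classical Hardy–Hilbert space on $\mathbb{D}$. For $p\in\mathbb{D}$, $\alpha_p(z)=\frac{p-z}{1-\overline{p}z}$. For $\psi$ holomorphic on $\mathbb{D}$ and $\varphi$ a holomorphic self-map of $\mathbb{D}$, the weighted composition operator is $W_{\psi,\varphi}f=\psi\cdot(f\circ\varphi)$. A bounded operator $T$ on a Hilbert space is algebraic if $P(T)=0$ for some nonzero complex polynomial $P$; the minimal degree of such a $P$ is called the degree of $T$. *)

(* Defs.v *)
From Stdlib Require Import Reals.
From Coquelicot Require Import Coquelicot.

Open Scope R_scope.

(* Functions on the disk are represented by total functions [C -> C]; only
   their values on the disk are ever used, and equality of such functions
   means equality on the disk. *)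
Definition disk (z : C) : Prop := Cmod z < 1.

Definition eq_on_disk (f g : C -> C) : Prop :=
  forall z : C, disk z -> f z = g z.

(* The disk is open, so [ex_derive] at its points does not see values of [f]
   outside it. *)
Definition holomorphic_on_disk (f : C -> C) : Prop :=
  forall z : C, disk z -> @ex_derive C_AbsRing C_NormedModule f z.

Definition alpha (p z : C) : C := ((p - z) / (1 - Cconj p * z))%C.

Definition Cexp (z : C) : C :=
  (RtoC (exp (Re z)) * (RtoC (cos (Im z)) + Ci * RtoC (sin (Im z))))%C.

(* The Hardy-Hilbert space: sums on the disk of power series with
   square-summable coefficients. *)
Definition H2_expansion (f : C -> C) (a : nat -> C) : Prop :=
  (forall z : C, disk z -> @is_pseries C_AbsRing C_NormedModule a z (f z)) /\
  ex_series (fun n : nat => Cmod (a n) ^ 2).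

Definition in_H2 (f : C -> C) : Prop := exists a : nat -> C, H2_expansion f a.

(* A relation, but functional: the coefficients of [f] are unique. *)
Definition is_H2_norm (f : C -> C) (r : R) : Prop :=
  exists a : nat -> C,
    H2_expansion f a /\ r = sqrt (Series (fun n : nat => Cmod (a n) ^ 2)).

(* The first clause says that [T] acts on functions on the disk. *)
Definition H2_bounded_operator (T : (C -> C) -> C -> C) : Prop :=
  (forall f g : C -> C,
     in_H2 f -> in_H2 g -> eq_on_disk f g -> eq_on_disk (T f) (T g)) /\
  (forall f : C -> C, in_H2 f -> in_H2 (T f)) /\
  (forall (c : C) (f g : C -> C), in_H2 f -> in_H2 g ->
     eq_on_disk (T (fun z => c * f z + g z)%C)
                (fun z => c * T f z + T g z)%C) /\
  (exists M : R, forall (f : C -> C) (r s : R),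
     is_H2_norm f r -> is_H2_norm (T f) s -> s <= M * r).

(* [P T = 0] on H^2 for some complex polynomial [P] of degree exactly [d],
   namely the one with coefficients [c 0], ..., [c d]; the condition
   [c d <> 0] makes [P] nonzero. *)
Definition H2_annihilated_in_degree (T : (C -> C) -> C -> C) (d : nat) : Prop :=
  exists c : nat -> C, c d <> RtoC 0 /\
    forall f : C -> C, in_H2 f ->
      eq_on_disk (fun z => sum_n (fun k => (c k * Nat.iter k T f z)%C) d)
                 (fun _ => RtoC 0).

Definition H2_algebraic_of_degree (T : (C -> C) -> C -> C) (n : nat) : Prop :=
  H2_annihilated_in_degree T n /\
  forall m : nat, H2_annihilated_in_degree T m -> (n <= m)%nat.

Definition weighted_comp (psi phi f : C -> C) : C -> C :=
  fun z => (psi z * f (phi z))%C.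

(* Main.v *)
Require Import Defs.
From Stdlib Require Import Reals Lra Lia Arith Classical ClassicalEpsilon Wf_nat.
From Coquelicot Require Import Coquelicot.

(** A polynomial relation [c0 + c1 W + c2 W^2 = 0] for [W f = psi (f o phi)]
    reads, at a point [z], as a linear relation between the evaluations of [f]
    at [z], [phi z] and [phi (phi z)].  Evaluations at distinct points are
    linearly independent on polynomials of degree at most 2, so testing [1],
    the identity and products of two linear factors forces coincidences among
    the three points ([relation_degenerate], [relation_linear],
    [relation_invertible]):

    - if [c2 = 0], the relations on [1] and on the identity make [psi] constant
      and [phi] the identity;
    - if [c0 = 0] and [c2 <> 0], some holomorphic function built from [psi]
      vanishes on an image of [phi], so that [phi] is constant or the function
      is zero, the zeros of a nonzero function being isolated; in the second
      case [psi] is a constant and [phi] is idempotent, hence constant or the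
      identity by the same argument;
    - if [c0] and [c2] are nonzero, then [phi (phi z) = z], [psi] has no
      zero, and either [phi] is the identity or [c1 = 0], in which case
      [psi z * psi (phi z)] is a constant.

    An involution [phi] of the disk other than the identity equals [alpha w]
    with [w = phi 0]: the map [alpha w o phi] and its inverse both fix the
    centre, so Schwarz' lemma makes it a rotation, which is trivial because
    [phi w = 0] when [w <> 0], and because [phi] is not the identity when
    [w = 0].  If [p] is the hyperbolic midpoint of [0] and [w], then
    [alpha w z = alpha p (- alpha p z)] ([involution_form]).  Then
    [g = psi o alpha p] satisfies [g z * g (- z) = c], hence [g' / g] is even
    and integrates to an odd function, of which [g] is the exponential
    ([exp_odd_representation]).  Conversely each of the three cases yields an
    explicit monic polynomial of degree 2 annihilating [W].

    The function theory rests on the equivalence of two notions on the disk: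
    sums of power series and functions with a continuous complex derivative.
    One direction is termwise differentiation ([power_series_C1]); the other
    is Cauchy's formula ([C1_power_series]).  Continuity of the derivatives
    comes for free: [psi] and [psi * phi] are the images under [W] of [1] and of
    the identity, so they are power series, and [phi] is their quotient wherever
    [psi] does not vanish. *)

(** * Continuity and differentiability in the plane *)

(** Continuity of a complex-valued map, kept as continuity of the two real
    parts so that the rules for real functions apply; the source may be the
    plane, a real parameter, or a pair of parameters. *)
Definition Ccont {X : UniformSpace} (g : X -> C) (x : X) : Prop :=
  continuous (fun y => Re (g y)) x /\ continuous (fun y => Im (g y)) x.

Section Ccont_rules.
Context {X : UniformSpace}.
Implicit Types g h : X -> C.

Lemma Ccont_const (c : C) (x : X) : Ccont (fun _ : X => c) x.
Proof. split; apply continuous_const. Qed.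

Lemma Ccont_plus g h x : Ccont g x -> Ccont h x -> Ccont (fun y => g y + h y)%C x.
Proof.
intros [a b] [c d]; split; [apply (continuous_ext (fun y => plus (Re (g y)) (Re (h y))))
 | apply (continuous_ext (fun y => plus (Im (g y)) (Im (h y))))]; try reflexivity;
 apply @continuous_plus; assumption.
Qed.

Lemma Ccont_opp g x : Ccont g x -> Ccont (fun y => - g y)%C x.
Proof.
intros [a b]; split; [apply (continuous_ext (fun y => opp (Re (g y))))
 | apply (continuous_ext (fun y => opp (Im (g y))))]; try reflexivity;
 apply @continuous_opp; assumption.
Qed.

Lemma Ccont_minus g h x : Ccont g x -> Ccont h x -> Ccont (fun y => g y - h y)%C x.
Proof. intros a b; apply Ccont_plus; [|apply Ccont_opp]; assumption. Qed.

Lemma Ccont_mult g h x : Ccont g x -> Ccont h x -> Ccont (fun y => g y * h y)%C x.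
Proof.
intros [a b] [c d]; split.
- apply (continuous_ext (fun y => minus (mult (Re (g y)) (Re (h y))) (mult (Im (g y)) (Im (h y))))).
  reflexivity.
  apply @continuous_minus; apply @continuous_mult; assumption.
- apply (continuous_ext (fun y => plus (mult (Re (g y)) (Im (h y))) (mult (Im (g y)) (Re (h y))))).
  reflexivity.
  apply @continuous_plus; apply @continuous_mult; assumption.
Qed.

Lemma Ccont_pow g n x : Ccont g x -> Ccont (fun y => g y ^ n)%C x.
Proof.
intros a; induction n as [|n IH]; simpl; [apply Ccont_const|].
apply Ccont_mult; assumption.
Qed.

Lemma Ccont_continuous g x : Ccont g x <-> continuous (g : X -> C_UniformSpace) x.
Proof.
split.
- intros [a b]. apply filterlim_locally. intros eps.
  generalize (filter_and _ _ (proj1 (filterlim_locally _ _) a eps) (proj1 (filterlim_locally _ _) b eps)).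
  apply filter_imp. intros y [u v]. split; assumption.
- intros a. split.
  + apply (continuous_comp (g : X -> C_UniformSpace) (fun z : C_UniformSpace => Re z)); [assumption|].
    apply (@continuous_fst R_UniformSpace R_UniformSpace).
  + apply (continuous_comp (g : X -> C_UniformSpace) (fun z : C_UniformSpace => Im z)); [assumption|].
    apply (@continuous_snd R_UniformSpace R_UniformSpace).
Qed.

Lemma Ccont_ext_loc g h x : locally x (fun y => g y = h y) -> Ccont g x -> Ccont h x.
Proof.
intros e [a b]; split;
 [apply continuous_ext_loc with (2 := a)|apply continuous_ext_loc with (2 := b)];
 revert e; apply filter_imp; intros y ->; reflexivity.
Qed.

Lemma Ccont_inv g x : Ccont g x -> g x <> 0 -> Ccont (fun y => / g y)%C x.
Proof.
intros [a b] nz.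
assert (nz' : Re (g x) ^ 2 + Im (g x) ^ 2 <> 0).
{ rewrite <- Cmod2_alt. apply pow_nonzero. intros e. apply nz, Cmod_eq_0, e. }
assert (D : continuous (fun y => / (Re (g y) ^ 2 + Im (g y) ^ 2)) x).
{ apply (continuous_comp (fun y => Re (g y) ^ 2 + Im (g y) ^ 2) Rinv);
    [|apply continuous_Rinv; assumption].
  apply (continuous_ext (fun y => plus (mult (Re (g y)) (Re (g y))) (mult (Im (g y)) (Im (g y))))).
  - intros y. unfold plus, mult; simpl. ring.
  - apply @continuous_plus; apply @continuous_mult; assumption. }
split.
- apply (continuous_ext (fun y => mult (Re (g y)) (/ (Re (g y) ^ 2 + Im (g y) ^ 2)))).
  reflexivity. apply @continuous_mult; assumption.
- apply (continuous_ext (fun y => mult (opp (Im (g y))) (/ (Re (g y) ^ 2 + Im (g y) ^ 2)))).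
  reflexivity. apply @continuous_mult; [apply @continuous_opp|]; assumption.
Qed.

Lemma Ccont_Cmod g x : Ccont g x -> continuous (fun y => Cmod (g y)) x.
Proof.
intros [a b]. unfold Cmod.
apply (continuous_comp (fun y => fst (g y) ^ 2 + snd (g y) ^ 2) sqrt).
- apply (continuous_ext (fun y => plus (mult (Re (g y)) (Re (g y))) (mult (Im (g y)) (Im (g y))))).
  + intros y. unfold plus, mult, Re, Im; simpl. ring.
  + apply @continuous_plus; apply @continuous_mult; assumption.
- apply continuous_sqrt.
Qed.

End Ccont_rules.

(** The outer map lives on the plane, so the proof passes through the product
    topology, which the componentwise notion does not mention. *)
Lemma Ccont_comp {X : UniformSpace} (f : C -> C) (g : X -> C) x :
  Ccont (X := C_UniformSpace) f (g x) -> Ccont g x -> Ccont (fun y => f (g y)) x.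
Proof.
intros a b. apply Ccont_continuous in a. apply Ccont_continuous in b. apply Ccont_continuous.
apply (continuous_comp (g : X -> C_UniformSpace) (f : C_UniformSpace -> C_UniformSpace)); assumption.
Qed.

Lemma Ccont_id (z : C) : Ccont (X := C_UniformSpace) (fun w : C => w) z.
Proof. apply Ccont_continuous. apply continuous_id. Qed.

Notation Ccont_at f z := (Ccont (X := C_UniformSpace) (f : C -> C) (z : C)).
Notation near z P := (@locally C_UniformSpace (z : C) (P : C -> Prop)).

(** The neighbourhoods are those of the product of two lines; the modulus
    defines the same ones, its balls and the squares differing by a factor
    [sqrt 2]. *)
Lemma near_Cmod (z : C) (P : C -> Prop) :
  near z P <-> exists d : posreal, forall w, Cmod (w - z) < d -> P w.
Proof.
split.
- intros [d H]. exists d. intros w Hw. apply H.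
  apply C_NormedModule_mixin_compat1. exact Hw.
- intros [d H]. 
  assert (s2 : 0 < sqrt 2) by (apply sqrt_lt_R0; lra).
  assert (p : 0 < d / sqrt 2) by (apply Rdiv_lt_0_compat; [apply cond_pos|lra]).
  exists (mkposreal _ p). intros w Hw. apply H.
  apply C_NormedModule_mixin_compat2 in Hw. simpl in Hw.
  replace (sqrt 2 * (d / sqrt 2)) with (pos d) in Hw by (field; lra). exact Hw.
Qed.

Lemma near_disk (z : C) : disk z -> near z disk.
Proof.
intros h. apply near_Cmod. unfold disk in h.
assert (p : 0 < 1 - Cmod z) by lra.
exists (mkposreal _ p). simpl. intros w Hw. unfold disk.
replace w with ((w - z) + z)%C by ring.
eapply Rle_lt_trans; [apply Cmod_triangle|]. lra.
Qed.

Lemma near_Cmod_lt (z : C) (r : R) : Cmod z < r -> near z (fun w => Cmod w < r).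
Proof.
intros h. apply near_Cmod.
assert (p : 0 < r - Cmod z) by lra.
exists (mkposreal _ p). simpl. intros w Hw.
replace w with ((w - z) + z)%C by ring.
eapply Rle_lt_trans; [apply Cmod_triangle|]. lra.
Qed.

Lemma near_all (z : C) (P : C -> Prop) : (forall w, P w) -> near z P.
Proof. intros h. apply filter_forall. exact h. Qed.

Lemma near_self (z : C) (P : C -> Prop) : near z P -> P z.
Proof. apply locally_singleton. Qed.

Lemma near_other (z : C) (P : C -> Prop) : near z P -> exists w, w <> z /\ P w.
Proof.
intros h. apply near_Cmod in h. destruct h as [d h].
exists (z + RtoC (d / 2))%C.
assert (hd := cond_pos d).
split.
- intros e. assert (e' : RtoC (d / 2) = 0).
  { replace (RtoC (d / 2)) with (z + RtoC (d / 2) - z)%C by ring. rewrite e. ring. }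
  apply RtoC_inj in e'. lra.
- apply h. replace (z + RtoC (d / 2) - z)%C with (RtoC (d / 2)) by ring.
  rewrite Cmod_R, Rabs_pos_eq; lra.
Qed.

Lemma Ccont_at_near (f : C -> C) (z : C) (P : C -> Prop) : Ccont_at f z -> near (f z) P -> near z (fun w => P (f w)).
Proof. intros a b. apply Ccont_continuous in a. apply a. exact b. Qed.

Lemma Ccont_at_neq0 (f : C -> C) (z : C) : Ccont_at f z -> f z <> 0 -> near z (fun w => f w <> 0).
Proof.
intros a nz. apply (Ccont_at_near f z (fun w => w <> 0)); [exact a|].
apply near_Cmod. apply Cmod_gt_0 in nz. exists (mkposreal _ nz). simpl.
intros w Hw ->. replace (RtoC 0 - f z)%C with (- f z)%C in Hw by ring.
rewrite Cmod_opp in Hw. lra.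
Qed.

Lemma Ccont_at_bound (f : C -> C) z K :
  near z (fun w => Cmod (f w - f z) <= K * Cmod (w - z)) -> Ccont_at f z.
Proof.
intros h. apply near_Cmod in h. destruct h as [d h].
apply Ccont_continuous. apply filterlim_locally. intros eps.
apply near_Cmod.
assert (pK : 0 < Rabs K + 1) by (assert (h1 := Rabs_pos K); lra).
assert (p : 0 < Rmin d (eps / (Rabs K + 1))).
{ apply Rmin_pos; [apply cond_pos|]. apply Rdiv_lt_0_compat; [apply cond_pos|lra]. }
exists (mkposreal _ p). simpl. intros w Hw.
apply C_NormedModule_mixin_compat1.
change (minus (f w) (f z)) with (f w - f z)%C.
assert (H1 := Rlt_le_trans _ _ _ Hw (Rmin_l _ _)).
assert (H2 := Rlt_le_trans _ _ _ Hw (Rmin_r _ _)).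
apply Rle_lt_trans with (1 := h w H1).
apply Rle_lt_trans with ((Rabs K + 1) * Cmod (w - z)).
- apply Rmult_le_compat_r; [apply Cmod_ge_0|]. assert (h2 := Rle_abs K); lra.
- apply Rmult_lt_compat_l with (r := Rabs K + 1) in H2; [|lra].
  replace ((Rabs K + 1) * (eps / (Rabs K + 1))) with (pos eps) in H2 by (field; lra).
  exact H2.
Qed.

(** Caratheodory's form of complex differentiability: the difference quotient
    extends continuously to the point.  It turns the rules of differentiation
    into algebraic identities followed by continuity of the quotient. *)
Definition Cderiv (f : C -> C) (z l : C) : Prop :=
  exists q : C -> C, Ccont_at q z /\ q z = l /\
    near z (fun w => f w - f z = q w * (w - z))%C.

Lemma Cderiv_cont (f : C -> C) (z : C) (l : C) : Cderiv f z l -> Ccont_at f z.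
Proof.
intros [q [a [_ e]]].
apply (Ccont_ext_loc (X := C_UniformSpace) (fun w => f z + q w * (w - z))%C).
- revert e. apply filter_imp. intros w e. rewrite <- e. ring.
- apply Ccont_plus; [apply Ccont_const|]. apply Ccont_mult; [exact a|].
  apply Ccont_minus; [apply Ccont_id|apply Ccont_const].
Qed.

Lemma Cderiv_ext_loc (f g : C -> C) (z : C) (l : C) :
  near z (fun w => f w = g w) -> Cderiv f z l -> Cderiv g z l.
Proof.
intros h [q [a [b e]]]. exists q. split; [exact a|split; [exact b|]].
assert (h0 := near_self _ _ h). rewrite <- h0.
generalize (filter_and _ _ h e). apply filter_imp.
intros w [<- ->]. reflexivity.
Qed.

Lemma Cderiv_const (c z : C) : Cderiv (fun _ => c) z 0.
Proof.
exists (fun _ => RtoC 0). split; [apply Ccont_const|split; [reflexivity|]].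
apply near_all. intros w. ring.
Qed.

Lemma Cderiv_id (z : C) : Cderiv (fun w => w) z 1.
Proof.
exists (fun _ => RtoC 1). split; [apply Ccont_const|split; [reflexivity|]].
apply near_all. intros w. ring.
Qed.

Lemma Cderiv_plus (f g : C -> C) (z : C) (l m : C) :
  Cderiv f z l -> Cderiv g z m -> Cderiv (fun w => f w + g w)%C z (l + m)%C.
Proof.
intros [q [a [b e]]] [s [c [d k]]].
exists (fun w => q w + s w)%C. split; [apply Ccont_plus; assumption|split; [congruence|]].
generalize (filter_and _ _ e k). apply filter_imp. intros w [e1 e2].
replace (f w + g w - (f z + g z))%C with ((f w - f z) + (g w - g z))%C by ring.
rewrite e1, e2. ring.
Qed.

Lemma Cderiv_mult (f g : C -> C) (z : C) (l m : C) :
  Cderiv f z l -> Cderiv g z m ->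
  Cderiv (fun w => f w * g w)%C z (l * g z + f z * m)%C.
Proof.
intros hf [s [c [d k]]]. assert (hc := Cderiv_cont _ _ _ hf).
destruct hf as [q [a [b e]]].
exists (fun w => q w * g z + f w * s w)%C. split; [|split; [congruence|]].
- apply Ccont_plus; apply Ccont_mult; try assumption. apply Ccont_const.
- generalize (filter_and _ _ e k). apply filter_imp. intros w [e1 e2].
  replace (f w * g w - (f z * g z))%C with ((f w - f z) * g z + f w * (g w - g z))%C by ring.
  rewrite e1, e2. ring.
Qed.

Lemma Cderiv_inv (f : C -> C) (z : C) (l : C) :
  Cderiv f z l -> f z <> 0 -> Cderiv (fun w => / f w)%C z (- l / (f z * f z))%C.
Proof.
intros hf nz. assert (hc := Cderiv_cont _ _ _ hf).
destruct hf as [q [a [b e]]].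
exists (fun w => - q w * / (f w * f z))%C. split; [|split; [rewrite b; reflexivity|]].
- apply Ccont_mult; [apply Ccont_opp; exact a|].
  apply Ccont_inv; [apply Ccont_mult; [exact hc|apply Ccont_const]|].
  apply Cmult_neq_0; exact nz.
- generalize (filter_and _ _ e (Ccont_at_neq0 _ _ hc nz)). apply filter_imp. intros w [e1 e2].
  transitivity (- (f w - f z) / (f w * f z))%C; [field; split; assumption|].
  rewrite e1. field. split; assumption.
Qed.

Lemma Cderiv_comp (f g : C -> C) (z : C) (l m : C) :
  Cderiv f (g z) l -> Cderiv g z m -> Cderiv (fun w => f (g w)) z (l * m)%C.
Proof.
intros [q [a [b e]]] hg. assert (hc := Cderiv_cont _ _ _ hg).
destruct hg as [s [c [d k]]].
exists (fun w => q (g w) * s w)%C. split; [|split; [congruence|]].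
- apply Ccont_mult; [|exact c]. apply (Ccont_comp (X := C_UniformSpace)); assumption.
- generalize (filter_and _ _ (Ccont_at_near _ _ _ hc e) k). apply filter_imp. intros w [e1 e2].
  rewrite e1, e2. ring.
Qed.

Lemma Ccont_at_eq_punctured (f g : C -> C) (z : C) :
  Ccont_at f z -> Ccont_at g z -> near z (fun w => w <> z -> f w = g w) -> f z = g z.
Proof.
intros a b h. apply NNPP. intros ne.
assert (nz : (f z - g z)%C <> 0) by (apply Cminus_eq_contra; exact ne).
assert (k := Ccont_at_neq0 (fun w => f w - g w)%C z (Ccont_minus _ _ _ a b) nz).
destruct (near_other _ _ (filter_and _ _ h k)) as [w [ne' [e n']]].
apply n'. rewrite e by exact ne'. ring.
Qed.

Lemma Cderiv_unique (f : C -> C) (z : C) (l m : C) : Cderiv f z l -> Cderiv f z m -> l = m.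
Proof.
intros [q [a [<- e]]] [s [c [<- k]]].
apply Ccont_at_eq_punctured; [exact a|exact c|].
generalize (filter_and _ _ e k). apply filter_imp. intros w [e1 e2] ne.
assert (nz : (w - z)%C <> 0) by (apply Cminus_eq_contra; exact ne).
rewrite e1 in e2.
transitivity (q w * (w - z) / (w - z))%C; [field; exact nz|].
rewrite e2. field. exact nz.
Qed.

(** How power series get their derivatives: a second-order remainder estimate
    makes the difference quotient Lipschitz at the point. *)
Lemma Cderiv_quadratic (f : C -> C) (z : C) l K :
  near z (fun w => Cmod (f w - f z - l * (w - z)) <= K * Cmod (w - z) ^ 2) ->
  Cderiv f z l.
Proof.
intros h.
exists (fun w => if Ceq_dec w z then l else (f w - f z) / (w - z))%C.
destruct (Ceq_dec z z) as [_|ne]; [|congruence].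
split; [|split; [reflexivity|]].
- apply Ccont_at_bound with (K := K).
  revert h. apply filter_imp. intros w h.
  destruct (Ceq_dec z z) as [_|ne]; [|congruence].
  destruct (Ceq_dec w z) as [->|ne].
  + replace (l - l)%C with (RtoC 0) by ring. replace (z - z)%C with (RtoC 0) by ring.
    rewrite Cmod_0. lra.
  + assert (nz : (w - z)%C <> 0) by (apply Cminus_eq_contra; exact ne).
    replace ((f w - f z) / (w - z) - l)%C with ((f w - f z - l * (w - z)) / (w - z))%C
      by (field; exact nz).
    rewrite Cmod_div by exact nz. apply Cmod_gt_0 in nz.
    apply Rmult_le_reg_r with (Cmod (w - z)); [exact nz|].
    replace (Cmod (f w - f z - l * (w - z)) / Cmod (w - z) * Cmod (w - z))
      with (Cmod (f w - f z - l * (w - z))) by (field; lra).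
    eapply Rle_trans; [exact h|]. right; ring.
- apply near_all. intros w. destruct (Ceq_dec w z) as [->|ne]; [ring|].
  field. apply Cminus_eq_contra; exact ne.
Qed.

(** The derivative is required to be continuous because differentiation under
    the integral sign, on which Cauchy's formula rests below, needs it. *)
Definition C1_disk (f : C -> C) : Prop :=
  exists f' : C -> C, forall z, disk z -> Cderiv f z (f' z) /\ Ccont_at f' z.

Lemma C1_cont (f : C -> C) (z : C) : C1_disk f -> disk z -> Ccont_at f z.
Proof. intros [f' h] dz. eapply Cderiv_cont. apply h, dz. Qed.

Lemma C1_ext f g : eq_on_disk f g -> C1_disk f -> C1_disk g.
Proof.
intros e [f' h]. exists f'. intros z dz. destruct (h z dz) as [a b]. split; [|exact b].
revert a. apply Cderiv_ext_loc. generalize (near_disk z dz). apply filter_imp. exact e.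
Qed.

Lemma C1_const c : C1_disk (fun _ => c).
Proof. exists (fun _ => RtoC 0). intros z _. split; [apply Cderiv_const|apply Ccont_const]. Qed.

Lemma C1_id : C1_disk (fun z => z).
Proof. exists (fun _ => RtoC 1). intros z _. split; [apply Cderiv_id|apply Ccont_const]. Qed.

Lemma C1_plus f g : C1_disk f -> C1_disk g -> C1_disk (fun z => f z + g z)%C.
Proof.
intros [f' hf] [g' hg]. exists (fun z => f' z + g' z)%C. intros z dz.
destruct (hf z dz), (hg z dz).
split; [apply Cderiv_plus|apply Ccont_plus]; assumption.
Qed.

Lemma C1_mult f g : C1_disk f -> C1_disk g -> C1_disk (fun z => f z * g z)%C.
Proof.
intros Hf Hg. assert (cf := fun z => C1_cont f z Hf). assert (cg := fun z => C1_cont g z Hg).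
destruct Hf as [f' hf], Hg as [g' hg].
exists (fun z => f' z * g z + f z * g' z)%C. intros z dz.
destruct (hf z dz), (hg z dz). specialize (cf z dz). specialize (cg z dz).
split; [apply Cderiv_mult; assumption|].
apply Ccont_plus; apply Ccont_mult; assumption.
Qed.

Lemma C1_minus f g : C1_disk f -> C1_disk g -> C1_disk (fun z => f z - g z)%C.
Proof.
intros a b. apply (C1_ext (fun z => f z + (-1) * g z)%C).
- intros z _. ring.
- apply C1_plus; [exact a|]. apply C1_mult; [apply C1_const|exact b].
Qed.

Lemma C1_pow f n : C1_disk f -> C1_disk (fun z => f z ^ n)%C.
Proof.
intros a. induction n as [|n IH]; simpl; [apply C1_const|]. apply C1_mult; assumption.
Qed.

Lemma C1_inv f : C1_disk f -> (forall z, disk z -> f z <> 0) -> C1_disk (fun z => / f z)%C.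
Proof.
intros Hf nz. assert (cf := fun z => C1_cont f z Hf). destruct Hf as [f' hf].
exists (fun z => - f' z / (f z * f z))%C. intros z dz.
destruct (hf z dz). specialize (cf z dz). specialize (nz z dz).
split; [apply Cderiv_inv; assumption|].
apply Ccont_mult; [apply Ccont_opp; assumption|].
apply Ccont_inv; [apply Ccont_mult; assumption|]. apply Cmult_neq_0; assumption.
Qed.

Lemma C1_div f g :
  C1_disk f -> C1_disk g -> (forall z, disk z -> g z <> 0) -> C1_disk (fun z => f z / g z)%C.
Proof. intros a b nz. apply C1_mult; [exact a|apply C1_inv; assumption]. Qed.

Lemma C1_comp f g :
  C1_disk f -> C1_disk g -> (forall z, disk z -> disk (g z)) -> C1_disk (fun z => f (g z)).
Proof.
intros Hf Hg dg. assert (cg := fun z => C1_cont g z Hg).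
destruct Hf as [f' hf], Hg as [g' hg].
exists (fun z => f' (g z) * g' z)%C. intros z dz.
destruct (hf _ (dg z dz)), (hg z dz). specialize (cg z dz).
split; [apply Cderiv_comp; assumption|].
apply Ccont_mult; [|assumption]. apply (Ccont_comp (X := C_UniformSpace)); assumption.
Qed.

(** * Power series *)

Notation Cseries u l := (@is_series C_AbsRing C_NormedModule (u : nat -> C) (l : C)).
Notation Csum_n u n := (@sum_n (NormedModule.AbelianMonoid C_AbsRing C_NormedModule) (u : nat -> C) n).

Lemma Cseries_unique u l m : Cseries u l -> Cseries u m -> l = m.
Proof. apply (filterlim_locally_unique (V := C_NormedModule) (F := eventually)). Qed.

Lemma Cseries_bounded u l : Cseries u l -> exists M, forall n, Cmod (u n) <= M.
Proof.
intros h. destruct (filterlim_bounded (V := C_NormedModule) _ (ex_intro _ l h)) as [M hM].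
assert (M0 : 0 <= M) by (eapply Rle_trans; [apply Cmod_ge_0|apply (hM O)]).
exists (2 * M). intros [|n].
- specialize (hM O). rewrite sum_O in hM. change (Cmod (u O) <= M) in hM. lra.
- assert (h1 := hM n). assert (h2 := hM (S n)). rewrite sum_Sn in h2.
  change (Cmod (Csum_n u n) <= M) in h1. change (Cmod (Csum_n u n + u (S n)) <= M) in h2.
  replace (u (S n)) with ((Csum_n u n + u (S n)) + - Csum_n u n)%C by ring.
  eapply Rle_trans; [apply Cmod_triangle|]. rewrite Cmod_opp. lra.
Qed.

Lemma Cseries_scal c u l : Cseries u l -> Cseries (fun n => c * u n)%C (c * l)%C.
Proof. apply (is_series_scal (V := C_NormedModule)). Qed.

Lemma Cseries_ext u v l : (forall n, u n = v n) -> Cseries u l -> Cseries v l.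
Proof. apply (is_series_ext (V := C_NormedModule)). Qed.

Lemma Cseries_minus u v l m : Cseries u l -> Cseries v m -> Cseries (fun n => u n - v n)%C (l - m)%C.
Proof. apply (is_series_minus (V := C_NormedModule)). Qed.

Lemma Cseries_le u (b : nat -> R) :
  (forall n, Cmod (u n) <= b n) -> ex_series b -> exists l, Cseries u l.
Proof. intros h hb. apply (ex_series_le (V := C_CompleteNormedModule) u b h hb). Qed.

Lemma Cseries_Cmod_le u l (b : nat -> R) B :
  (forall n, Cmod (u n) <= b n) -> is_series b B -> Cseries u l -> Cmod l <= B.
Proof.
intros h hb hu.
apply (filterlim_le (F := eventually) (fun n => Cmod (Csum_n u n)) (sum_n b) (Cmod l) B).
- apply filter_forall. intros n.
  eapply Rle_trans; [apply (norm_sum_n_m (V := C_NormedModule))|].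
  apply sum_n_m_le. exact h.
- apply (filterlim_comp _ _ _ _ _ _ _ _ hu). apply (filterlim_norm (V := C_NormedModule)).
- exact hb.
Qed.

Definition power_series_on (rho : R) (a : nat -> C) (f : C -> C) : Prop :=
  forall z, Cmod z < rho -> Cseries (fun n => a n * z ^ n)%C (f z).

Lemma pow_n_Cpow (z : C) n : @pow_n C_Ring z n = (z ^ n)%C.
Proof. induction n as [|n IH]; [reflexivity|]. simpl. rewrite IH. reflexivity. Qed.

Lemma is_pseries_Cseries a z l :
  @is_pseries C_AbsRing C_NormedModule a z l <-> Cseries (fun n => a n * z ^ n)%C l.
Proof.
unfold is_pseries. split; apply Cseries_ext; intros n;
rewrite <- (pow_n_Cpow z n);
change (scal (pow_n z n) (a n)) with (@pow_n C_Ring z n * a n)%C; apply Cmult_comm.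
Qed.

(** The coefficients are bounded by a geometric sequence of any ratio above
    [1 / rho]; passing to their moduli gives access to the theory of real power
    series, in particular to its stability under differentiation. *)
Lemma power_series_radius rho a f s :
  power_series_on rho a f -> 0 <= s < rho -> Rbar_lt s (CV_radius (fun n => Cmod (a n))).
Proof.
intros h hs. set (t := (s + rho) / 2). assert (ht : s < t < rho) by (unfold t; lra).
apply Rbar_lt_le_trans with t; [apply ht|].
apply (CV_radius_bounded (fun n => Cmod (a n))).
destruct (Cseries_bounded _ _ (h (RtoC t) ltac:(rewrite Cmod_R, Rabs_pos_eq; lra))) as [M hM].
exists M. intros n. rewrite Rabs_pos_eq.
- eapply Rle_trans; [|apply (hM n)]. right.
  rewrite Cmod_mult, Cmod_pow, Cmod_R, (Rabs_pos_eq t); lra.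
- apply Rmult_le_pos; [apply Cmod_ge_0|]. apply pow_le. lra.
Qed.

Lemma ex_series_radius (b : nat -> R) s :
  (forall n, 0 <= b n) -> 0 <= s -> Rbar_lt s (CV_radius b) ->
  ex_series (fun n => b n * s ^ n).
Proof.
intros hb s0 h. eapply ex_series_ext; [|apply CV_disk_inside with (a := b) (x := s)].
- intros n. simpl. apply Rabs_pos_eq. apply Rmult_le_pos; [apply hb|apply pow_le, s0].
- rewrite Rabs_pos_eq; assumption.
Qed.

(** Pointwise sums are collected into a function by choice. *)
Lemma power_series_exists rho a :
  (forall z, Cmod z < rho -> exists l, Cseries (fun n => a n * z ^ n)%C l) ->
  exists f, power_series_on rho a f.
Proof.
intros h. exists (fun z => epsilon (inhabits (RtoC 0)) (fun l => Cseries (fun n => a n * z ^ n)%C l)).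
intros z hz. apply epsilon_spec. apply h, hz.
Qed.

Definition derived_coef (a : nat -> C) (n : nat) : C := (RtoC (INR (S n)) * a (S n))%C.

(** The Taylor remainder of a monomial, bounded by its second derivative at
    [s].  The induction step is the identity
    [T (m + 1) = w T m + m z^(m - 1) (w - z)^2] for the remainder [T m]. *)
Lemma Cpow_diff_bound (z w : C) s n :
  Cmod z <= s -> Cmod w <= s ->
  Cmod (w ^ (S (S n)) - z ^ (S (S n)) - RtoC (INR (S (S n))) * z ^ (S n) * (w - z))
   <= INR (S (S n)) * INR (S n) * s ^ n * Cmod (w - z) ^ 2.
Proof.
intros hz hw. assert (s0 : 0 <= s) by (eapply Rle_trans; [apply Cmod_ge_0|exact hz]).
induction n as [|n IH].
- replace (w ^ 2 - z ^ 2 - RtoC (INR 2) * z ^ 1 * (w - z))%C with ((w - z) ^ 2)%C.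
  + rewrite Cmod_pow. simpl. nra.
  + simpl INR. rewrite RtoC_plus. simpl. ring.
- set (m := S (S n)) in *.
  replace (w ^ S m - z ^ S m - RtoC (INR (S m)) * z ^ m * (w - z))%C with
    (w * (w ^ m - z ^ m - RtoC (INR m) * z ^ (S n) * (w - z))
      + RtoC (INR m) * z ^ (S n) * (w - z) ^ 2)%C.
  2:{ rewrite (S_INR m), RtoC_plus. unfold m. simpl. ring. }
  eapply Rle_trans; [apply Cmod_triangle|].
  rewrite !Cmod_mult, !Cmod_pow, Cmod_R, (Rabs_pos_eq _ (pos_INR m)).
  set (h := Cmod (w - z)) in *. assert (h0 : 0 <= h) by apply Cmod_ge_0.
  assert (A : Cmod w * Cmod (w ^ m - z ^ m - RtoC (INR m) * z ^ S n * (w - z))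
    <= s * (INR m * INR (S n) * s ^ n * h ^ 2)).
  { apply Rmult_le_compat; try apply Cmod_ge_0; assumption. }
  assert (B : INR m * Cmod z ^ S n * h ^ 2 <= INR m * s ^ S n * h ^ 2).
  { apply Rmult_le_compat_r; [apply pow_le, h0|].
    apply Rmult_le_compat_l; [apply pos_INR|]. apply pow_incr. split; [apply Cmod_ge_0|exact hz]. }
  eapply Rle_trans; [apply Rplus_le_compat; [exact A|exact B]|].
  assert (D : 0 <= s ^ S n * h ^ 2) by (apply Rmult_le_pos; apply pow_le; assumption).
  rewrite (S_INR m). assert (E : INR m = INR (S n) + 1) by apply S_INR.
  assert (F := pos_INR m).
  replace (s * (INR m * INR (S n) * s ^ n * h ^ 2) + INR m * s ^ S n * h ^ 2)
    with (INR m * INR m * (s ^ S n * h ^ 2)) by (rewrite E; simpl; ring).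
  replace ((INR m + 1) * INR m * s ^ S n * h ^ 2) with ((INR m + 1) * INR m * (s ^ S n * h ^ 2)) by ring.
  apply Rmult_le_compat_r; [exact D|]. nra.
Qed.

Lemma Cseries_tail u l :
  Cseries u l -> Cseries (fun n => u (S n)) (l - u O)%C.
Proof.
intros h. apply (is_series_incr_1 (V := C_NormedModule)).
match goal with |- is_series _ ?x => replace x with l end; [exact h|].
change (l = (l - u O) + u O)%C. ring.
Qed.

Lemma Cseries_cons u l :
  Cseries (fun n => u (S n)) (l - u O)%C -> Cseries u l.
Proof. intros h. apply (is_series_decr_1 (V := C_NormedModule)). exact h. Qed.

Lemma Cseries_zero : Cseries (fun _ => RtoC 0) 0.
Proof.
apply (filterlim_ext (fun _ : nat => RtoC 0)); [|apply filterlim_const].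
intros n. induction n as [|n IH]; [rewrite sum_O; reflexivity|].
rewrite sum_Sn, <- IH. symmetry. apply (Cplus_0_l 0).
Qed.

Lemma Cseries_at_0 (a : nat -> C) : Cseries (fun n => a n * 0 ^ n)%C (a O).
Proof.
apply Cseries_cons. apply (Cseries_ext (fun _ => RtoC 0)).
- intros n. simpl. ring.
- replace (a O - a O * 0 ^ 0)%C with (RtoC 0) by (simpl; ring). apply Cseries_zero.
Qed.

(** The remainder of the series is dominated, monomial by monomial, by the
    second derived series of the moduli at some [s] strictly between [|z|] and
    [rho], times [|w - z|^2]. *)
Theorem power_series_derive rho a f :
  power_series_on rho a f ->
  exists f', power_series_on rho (derived_coef a) f' /\ forall z, Cmod z < rho -> Cderiv f z (f' z).
Proof.
intros h.
assert (R1 : forall s, 0 <= s < rho -> Rbar_lt s (CV_radius (PS_derive (fun n => Cmod (a n))))).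
{ intros s hs. rewrite CV_radius_derive. eapply power_series_radius; eassumption. }
destruct (power_series_exists rho (derived_coef a)) as [f' hf'].
{ intros z hz.
  apply (Cseries_le _ (fun n => PS_derive (fun n => Cmod (a n)) n * Cmod z ^ n)).
  - intros n. unfold derived_coef, PS_derive.
    rewrite !Cmod_mult, Cmod_pow, Cmod_R, (Rabs_pos_eq _ (pos_INR _)). lra.
  - assert (z0 := Cmod_ge_0 z).
    apply ex_series_radius; [|exact z0|apply R1; lra].
    intros n. unfold PS_derive. apply Rmult_le_pos; [apply pos_INR|apply Cmod_ge_0]. }
exists f'. split; [exact hf'|].
intros z hz. set (s := (Cmod z + rho) / 2).
assert (z0 := Cmod_ge_0 z). assert (hs : Cmod z < s < rho) by (unfold s; lra).
set (b := PS_derive (PS_derive (fun n => Cmod (a n)))).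
assert (b0 : forall n, 0 <= b n).
{ intros n. unfold b, PS_derive.
  repeat (apply Rmult_le_pos; [apply pos_INR|]). apply Cmod_ge_0. }
assert (hb : ex_series (fun n => b n * s ^ n)).
{ apply ex_series_radius; [exact b0|lra|].
  unfold b. rewrite CV_radius_derive. apply R1. lra. }
destruct hb as [K hK].
(* [K] is the sum of the second derived series of the moduli at [s]. *)
apply Cderiv_quadratic with (K := K).
generalize (near_Cmod_lt z s (proj1 hs)). apply filter_imp. intros w hw.
assert (S1 := h w ltac:(lra)). assert (S2 := h z hz).
assert (S3 := hf' z hz).
assert (S4 : Cseries (fun n => match n with O => RtoC 0 | S m => RtoC (INR n) * a n * z ^ m end)%C (f' z)).
{ apply Cseries_cons.
  apply (Cseries_ext (fun n => derived_coef a n * z ^ n)%C); [intros n; reflexivity|].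
  replace (f' z - 0)%C with (f' z) by ring. exact S3. }
assert (S5 := Cseries_minus _ _ _ _ (Cseries_minus _ _ _ _ S1 S2) (Cseries_scal (w - z)%C _ _ S4)).
assert (S6 := Cseries_tail _ _ (Cseries_tail _ _ S5)).
eapply Cseries_Cmod_le; [|apply is_series_scal_r with (c := Cmod (w - z) ^ 2), hK|].
2:{ replace (f w - f z - f' z * (w - z))%C with
    (f w - f z - (w - z) * f' z - (a 0%nat * w ^ 0 - a 0%nat * z ^ 0 - (w - z) * 0) -
       (a 1%nat * w ^ 1 - a 1%nat * z ^ 1 - (w - z) * (RtoC (INR 1) * a 1%nat * z ^ 0)))%C
    by (simpl; ring).
    exact S6. }
intros n. cbv beta iota.
replace (a (S (S n)) * w ^ S (S n) - a (S (S n)) * z ^ S (S n) -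
   (w - z) * (RtoC (INR (S (S n))) * a (S (S n)) * z ^ S n))%C
 with (a (S (S n)) * (w ^ S (S n) - z ^ S (S n) - RtoC (INR (S (S n))) * z ^ S n * (w - z)))%C by ring.
rewrite Cmod_mult.
eapply Rle_trans.
- apply Rmult_le_compat_l; [apply Cmod_ge_0|].
  apply (Cpow_diff_bound z w s n); lra.
- right. unfold b, PS_derive. ring.
Qed.

Lemma power_series_C1 a f : power_series_on 1 a f -> C1_disk f.
Proof.
intros h. destruct (power_series_derive _ _ _ h) as [f' [h' d]].
destruct (power_series_derive _ _ _ h') as [f'' [_ d']].
exists f'. intros z hz. split; [apply d, hz|]. eapply Cderiv_cont. apply d', hz.
Qed.

(** Let [a k] be the first nonzero coefficient: then [f z = z^k g z] with [g] a
    power series, and [g] does not vanish near the centre because it is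
    continuous there with [g 0 = a k]. *)
Lemma power_series_zero_isolated rho a f :
  0 < rho -> power_series_on rho a f ->
  (forall n, a n = 0) \/ near 0 (fun z => z <> 0 -> f z <> 0).
Proof.
intros hr h.
destruct (classic (forall n, a n = 0)) as [e|ne]; [left; exact e|right].
assert (ex : exists k, a k <> 0) by (apply not_all_ex_not in ne; exact ne).
destruct (dec_inh_nat_subset_has_unique_least_element (fun k => a k <> 0)
  (fun k => classic _) ex) as [k [[ak least] _]].
assert (below : forall j, (j < k)%nat -> a j = 0).
{ intros j hj. apply NNPP. intros nz. specialize (least j nz). lia. }
clear ne ex least.
(* The powers of [z] are split off one at a time, each division by [z]
   shifting the coefficients by one. *)
assert (T : forall j, (j <= k)%nat -> exists g, power_series_on rho (fun n => a (j + n)%nat) g /\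
   forall z, Cmod z < rho -> f z = (z ^ j * g z)%C).
{ induction j as [|j IH]; intros hj.
  - exists f. split; [exact h|]. intros z _. simpl. ring.
  - destruct (IH ltac:(lia)) as [g [hg eg]].
    destruct (power_series_exists rho (fun n => a (S j + n)%nat)) as [g' hg'].
    { intros z hz. destruct (Ceq_dec z 0) as [->|nz].
      - exists (a (S j + 0)%nat). apply (Cseries_at_0 (fun n => a (S j + n)%nat)).
      - exists (/ z * (g z - a (j + 0)%nat * z ^ 0))%C.
        apply (Cseries_ext (fun n => / z * (a (j + S n)%nat * z ^ (S n)))%C).
        + intros n. replace (j + S n)%nat with (S j + n)%nat by lia. simpl. field. exact nz.
        + apply Cseries_scal. apply Cseries_tail with (u := fun n => (a (j + n)%nat * z ^ n)%C).
          apply hg, hz. }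
    exists g'. split; [exact hg'|].
    intros z hz. rewrite eg by exact hz.
    replace (g z) with (z * g' z)%C; [simpl; ring|].
    apply (Cseries_unique (fun n => a (j + n)%nat * z ^ n)%C); [|apply hg, hz].
    apply Cseries_cons.
    replace (j + 0)%nat with j by lia. rewrite (below j) by lia.
    replace (z * g' z - 0 * z ^ 0)%C with (z * g' z)%C by ring.
    apply (Cseries_ext (fun n => z * (a (S j + n)%nat * z ^ n))%C).
    + intros n. replace (j + S n)%nat with (S j + n)%nat by lia. simpl. ring.
    + apply Cseries_scal. apply hg', hz. }
destruct (T k ltac:(lia)) as [g [hg eg]].
assert (g0 : g 0 = a k).
{ apply (Cseries_unique (fun n => a (k + n)%nat * 0 ^ n)%C); [apply hg; rewrite Cmod_0; exact hr|].
  replace (a k) with (a (k + 0)%nat) by (f_equal; lia).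
  apply (Cseries_at_0 (fun n => a (k + n)%nat)). }
destruct (power_series_derive _ _ _ hg) as [g' [_ d]].
assert (c0 : Cmod 0 < rho) by (rewrite Cmod_0; exact hr).
assert (cg := Cderiv_cont _ _ _ (d 0 c0)).
generalize (filter_and _ _ (near_Cmod_lt 0 rho c0)
  (Ccont_at_neq0 g 0 cg ltac:(rewrite g0; exact ak))).
apply filter_imp. intros z [hz gz] nz. rewrite eg by exact hz.
apply Cmult_neq_0; [apply Cpow_nz, nz|exact gz].
Qed.

Lemma power_series_unique rho a b f :
  0 < rho -> power_series_on rho a f -> power_series_on rho b f -> forall n, a n = b n.
Proof.
intros hr ha hb n.
destruct (power_series_zero_isolated rho (fun n => a n - b n)%C (fun _ => RtoC 0) hr) as [e|e].
- intros z hz. replace (RtoC 0) with (f z - f z)%C by ring.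
  apply (Cseries_ext (fun n => a n * z ^ n - b n * z ^ n)%C); [intros k; ring|].
  apply Cseries_minus; [apply ha, hz|apply hb, hz].
- apply Ceq_minus. apply e.
- destruct (near_other _ _ e) as [w [nw h]]. exfalso. apply (h nw). reflexivity.
Qed.

(** * Derivatives along curves *)

Lemma C_ext (z w : C) : Re z = Re w -> Im z = Im w -> z = w.
Proof. destruct z, w. unfold Re, Im; simpl. intros -> ->. reflexivity. Qed.

Ltac to_R_eq := match goal with |- @eq _ ?a ?b => change (@eq R a b) end.

Definition curve_deriv (g : R -> C) (t : R) (l : C) : Prop :=
  is_derive (fun s => Re (g s)) t (Re l) /\ is_derive (fun s => Im (g s)) t (Im l).

Lemma curve_deriv_cont g t l : curve_deriv g t l -> Ccont (X := R_UniformSpace) g t.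
Proof.
intros [a b]; split; apply @ex_derive_continuous; eexists; eassumption.
Qed.

(** The factor [c] need only be continuous, because the other factor vanishes
    at the point: this is what differentiating Caratheodory's quotient along
    a curve requires. *)
Lemma is_derive_mult_vanishing (c x : R -> R) (t l : R) :
  continuous c t -> is_derive x t l ->
  is_derive (fun s => c s * (x s - x t)) t (c t * l).
Proof.
intros hc hx. apply is_derive_Reals. apply is_derive_Reals in hx.
intros eps he.
assert (p1 : 0 < Rmin 1 (eps / (2 * (Rabs (c t) + 1)))).
{ apply Rmin_pos; [lra|]. apply Rdiv_lt_0_compat; [lra|]. assert (h := Rabs_pos (c t)). lra. }
destruct (hx _ p1) as [d1 h1].
assert (p2 : 0 < eps / (2 * (Rabs l + 1))).
{ apply Rdiv_lt_0_compat; [lra|]. assert (h := Rabs_pos l). lra. }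
destruct (proj1 (filterlim_locally _ _) hc (mkposreal _ p2)) as [d2 h2].
assert (pd : 0 < Rmin d1 d2) by (apply Rmin_pos; apply cond_pos).
exists (mkposreal _ pd). simpl. intros h nh hh.
specialize (h1 h nh (Rlt_le_trans _ _ _ hh (Rmin_l _ _))).
assert (h2' := h2 (t + h)).
assert (bt : ball t d2 (t + h)).
{ change (Rabs (t + h - t) < d2). replace (t + h - t) with h by ring.
  exact (Rlt_le_trans _ _ _ hh (Rmin_r _ _)). }
specialize (h2' bt). change (Rabs (c (t + h) - c t) < eps / (2 * (Rabs l + 1))) in h2'.
set (D := (x (t + h) - x t) / h) in *.
replace ((c (t + h) * (x (t + h) - x t) - c t * (x t - x t)) / h - c t * l)
  with ((c (t + h) - c t) * D + c t * (D - l)) by (unfold D; field; exact nh).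
assert (hl : Rabs D <= Rabs l + 1).
{ replace D with (l + (D - l)) by ring. eapply Rle_trans; [apply Rabs_triang|].
  assert (h3 := Rlt_le_trans _ _ _ h1 (Rmin_l _ _)). lra. }
assert (h4 := Rlt_le_trans _ _ _ h1 (Rmin_r _ _)).
eapply Rle_lt_trans; [apply Rabs_triang|]. rewrite !Rabs_mult.
assert (hc0 := Rabs_pos (c t)). assert (hl0 := Rabs_pos l).
assert (B1 : Rabs (c (t + h) - c t) * Rabs D <= Rabs (c (t + h) - c t) * (Rabs l + 1)).
{ apply Rmult_le_compat_l; [apply Rabs_pos|exact hl]. }
assert (B2 : Rabs (c (t + h) - c t) * (Rabs l + 1) < eps / 2).
{ replace (eps / 2) with (eps / (2 * (Rabs l + 1)) * (Rabs l + 1)) by (field; lra).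
  apply Rmult_lt_compat_r; [lra|exact h2']. }
assert (B3 : Rabs (c t) * Rabs (D - l) <= (Rabs (c t) + 1) * Rabs (D - l)).
{ apply Rmult_le_compat_r; [apply Rabs_pos|lra]. }
assert (B4 : (Rabs (c t) + 1) * Rabs (D - l) < eps / 2).
{ replace (eps / 2) with ((Rabs (c t) + 1) * (eps / (2 * (Rabs (c t) + 1)))) by (field; lra).
  apply Rmult_lt_compat_l; [lra|exact h4]. }
lra.
Qed.

Lemma curve_deriv_comp (f : C -> C) (g : R -> C) t l m :
  Cderiv f (g t) l -> curve_deriv g t m -> curve_deriv (fun s => f (g s)) t (l * m)%C.
Proof.
intros [q [cq [<- e]]] hg. assert (cg := curve_deriv_cont _ _ _ hg).
destruct hg as [gr gi].
assert (cqg := Ccont_comp (X := R_UniformSpace) q g t cq cg).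
assert (L : @locally R_UniformSpace t
   (fun s => f (g s) = f (g t) + q (g s) * (g s - g t))%C).
{ apply Ccont_continuous in cg. generalize (cg _ e). unfold filtermap. apply filter_imp.
  intros s <-. ring. }
destruct cqg as [qr qi].
assert (A1 := is_derive_mult_vanishing _ _ _ _ qr gr).
assert (A2 := is_derive_mult_vanishing _ _ _ _ qi gi).
assert (A3 := is_derive_mult_vanishing _ _ _ _ qr gi).
assert (A4 := is_derive_mult_vanishing _ _ _ _ qi gr).
split.
- apply (is_derive_ext_loc (V := R_NormedModule) (fun s => Re (f (g t)) +
    (Re (q (g s)) * (Re (g s) - Re (g t)) - Im (q (g s)) * (Im (g s) - Im (g t))))).
  { revert L. apply filter_imp. intros s ->. rewrite re_plus, re_mult.
    unfold Cminus. rewrite re_plus, im_plus, re_opp, im_opp. to_R_eq. ring. }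
  rewrite re_mult. rewrite <- (Rplus_0_l (_ - _)).
  apply (is_derive_plus (V := R_NormedModule)); [apply (is_derive_const (V := R_NormedModule))|].
  apply (is_derive_minus (V := R_NormedModule)); assumption.
- apply (is_derive_ext_loc (V := R_NormedModule) (fun s => Im (f (g t)) +
    (Re (q (g s)) * (Im (g s) - Im (g t)) + Im (q (g s)) * (Re (g s) - Re (g t))))).
  { revert L. apply filter_imp. intros s ->. rewrite im_plus, im_mult.
    unfold Cminus. rewrite re_plus, im_plus, re_opp, im_opp. to_R_eq. ring. }
  rewrite im_mult. rewrite <- (Rplus_0_l (_ + _)).
  apply (is_derive_plus (V := R_NormedModule)); [apply (is_derive_const (V := R_NormedModule))|].
  apply (is_derive_plus (V := R_NormedModule)); assumption.
Qed.

Lemma curve_deriv_RtoC t : curve_deriv RtoC t 1.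
Proof.
split; simpl.
- apply (is_derive_id (K := R_AbsRing)).
- apply (is_derive_const (V := R_NormedModule)).
Qed.

Lemma Cderiv_affine a b z : Cderiv (fun w => a + w * b)%C z b.
Proof.
assert (h := Cderiv_plus _ _ _ _ _ (Cderiv_const a z)
   (Cderiv_mult _ _ _ _ _ (Cderiv_id z) (Cderiv_const b z))).
cbv beta in h. replace (0 + (1 * b + z * 0))%C with b in h by ring. exact h.
Qed.

Lemma Cderiv_pow n z : Cderiv (fun w => w ^ (S n))%C z (RtoC (INR (S n)) * z ^ n)%C.
Proof.
induction n as [|n IH].
- apply (Cderiv_ext_loc (fun w => w)); [apply near_all; intros w; simpl; ring|].
  replace (RtoC (INR 1) * z ^ 0)%C with (RtoC 1) by (simpl; ring). apply Cderiv_id.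
- assert (h := Cderiv_mult _ _ _ _ _ (Cderiv_id z) IH).
  replace (RtoC (INR (S (S n))) * z ^ S n)%C
    with (1 * z ^ S n + z * (RtoC (INR (S n)) * z ^ n))%C; [exact h|].
  rewrite (S_INR (S n)), RtoC_plus. simpl. ring.
Qed.

(** * Cauchy's formula on circles *)

Definition circle (r t : R) : C := (RtoC r * (cos t, sin t))%C.

Lemma Cmod_circle r t : 0 <= r -> Cmod (circle r t) = r.
Proof.
intros hr. unfold circle. rewrite Cmod_mult, Cmod_R, Rabs_pos_eq by exact hr.
unfold Cmod; simpl. assert (h := sin2_cos2 t). unfold Rsqr in h.
replace (cos t * (cos t * 1) + sin t * (sin t * 1)) with 1 by lra.
rewrite sqrt_1. ring.
Qed.

Lemma circle_period r : circle r (2 * PI) = circle r 0.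
Proof. unfold circle. rewrite cos_2PI, sin_2PI, cos_0, sin_0. reflexivity. Qed.

Lemma curve_deriv_circle r t : curve_deriv (circle r) t (Ci * circle r t)%C.
Proof.
split; unfold circle, Re, Im; simpl; auto_derive; trivial; ring.
Qed.

Lemma Ccont_circle {X : UniformSpace} r (u : X -> R) x :
  continuous u x -> Ccont (fun y => circle r (u y)) x.
Proof.
intros h. unfold circle. apply Ccont_mult; [apply Ccont_const|].
split.
- apply (continuous_comp u cos); [exact h|apply continuous_cos].
- apply (continuous_comp u sin); [exact h|apply continuous_sin].
Qed.

Definition Cint (g : R -> C) : C :=
  (RInt (fun t => Re (g t)) 0 (2 * PI), RInt (fun t => Im (g t)) 0 (2 * PI)).

Definition curve_cont (g : R -> C) : Prop := forall t, Ccont (X := R_UniformSpace) g t.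

Lemma curve_ex_RInt_Re g : curve_cont g -> ex_RInt (fun t => Re (g t)) 0 (2 * PI).
Proof. intros h. apply (ex_RInt_continuous (V := R_CompleteNormedModule)). intros t _. apply h. Qed.

Lemma curve_ex_RInt_Im g : curve_cont g -> ex_RInt (fun t => Im (g t)) 0 (2 * PI).
Proof. intros h. apply (ex_RInt_continuous (V := R_CompleteNormedModule)). intros t _. apply h. Qed.

Lemma Cint_ext g h : (forall t, g t = h t) -> Cint g = Cint h.
Proof.
intros e. unfold Cint. f_equal; apply RInt_ext; intros t _; rewrite e; reflexivity.
Qed.

Lemma Cint_plus g h : curve_cont g -> curve_cont h ->
  Cint (fun t => g t + h t)%C = (Cint g + Cint h)%C.
Proof.
intros a b.
apply C_ext; simpl; apply (RInt_plus (V := R_CompleteNormedModule));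
auto using curve_ex_RInt_Re, curve_ex_RInt_Im.
Qed.

Lemma Cint_scal c g : curve_cont g -> Cint (fun t => c * g t)%C = (c * Cint g)%C.
Proof.
intros a. assert (hr := curve_ex_RInt_Re _ a). assert (hi := curve_ex_RInt_Im _ a).
destruct c as [x y]. apply C_ext; unfold Re, Im; simpl.
- assert (s1 := ex_RInt_scal (V := R_CompleteNormedModule) _ _ _ x hr).
  assert (s2 := ex_RInt_scal (V := R_CompleteNormedModule) _ _ _ y hi).
  assert (E := RInt_minus (V := R_CompleteNormedModule) _ _ _ _ s1 s2).
  rewrite !(RInt_scal (V := R_CompleteNormedModule)) in E by assumption. exact E.
- assert (s1 := ex_RInt_scal (V := R_CompleteNormedModule) _ _ _ x hi).
  assert (s2 := ex_RInt_scal (V := R_CompleteNormedModule) _ _ _ y hr).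
  assert (E := RInt_plus (V := R_CompleteNormedModule) _ _ _ _ s1 s2).
  rewrite !(RInt_scal (V := R_CompleteNormedModule)) in E by assumption. exact E.
Qed.

Lemma Cmod_le_abs z : Cmod z <= Rabs (Re z) + Rabs (Im z).
Proof.
replace z with (RtoC (Re z) + Ci * RtoC (Im z))%C at 1
  by (apply C_ext; unfold Re, Im; simpl; ring).
eapply Rle_trans; [apply Cmod_triangle|].
rewrite Cmod_mult, Cmod_Ci, !Cmod_R. lra.
Qed.

Lemma im_le_Cmod z : Rabs (Im z) <= Cmod z.
Proof. eapply Rle_trans; [apply Rmax_r|apply Rmax_Cmod]. Qed.

(** Bounding the two real parts separately costs a harmless factor 2. *)
Lemma Cint_bound g (b : R -> R) :
  curve_cont g -> (forall t, continuous b t) -> (forall t, Cmod (g t) <= b t) ->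
  Cmod (Cint g) <= 2 * RInt b 0 (2 * PI).
Proof.
intros hg hb h.
assert (hp : 0 <= 2 * PI) by (assert (h1 := PI_RGT_0); lra).
assert (ib := RInt_correct (V := R_CompleteNormedModule) b 0 (2 * PI)
  (ex_RInt_continuous (V := R_CompleteNormedModule) _ _ _ (fun t _ => hb t))).
eapply Rle_trans; [apply Cmod_le_abs|]. simpl.
assert (A : Rabs (RInt (fun t => Re (g t)) 0 (2 * PI)) <= RInt b 0 (2 * PI)).
{ apply (norm_RInt_le (V := R_NormedModule) (fun t => Re (g t)) b 0 (2 * PI)); try assumption.
  - intros t _. eapply Rle_trans; [apply re_le_Cmod|apply h].
  - apply (RInt_correct (V := R_CompleteNormedModule)), curve_ex_RInt_Re, hg. }
assert (B : Rabs (RInt (fun t => Im (g t)) 0 (2 * PI)) <= RInt b 0 (2 * PI)).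
{ apply (norm_RInt_le (V := R_NormedModule) (fun t => Im (g t)) b 0 (2 * PI)); try assumption.
  - intros t _. eapply Rle_trans; [apply im_le_Cmod|apply h].
  - apply (RInt_correct (V := R_CompleteNormedModule)), curve_ex_RInt_Im, hg. }
lra.
Qed.

Lemma circle_neq r z t : 0 <= r -> Cmod z < r -> (circle r t - z)%C <> 0.
Proof.
intros hr hz. apply Cminus_eq_contra. intros e.
assert (h := Cmod_circle r t hr). rewrite e in h. lra.
Qed.

(** The Cauchy kernel [d zeta / (zeta - z)] on the circle in terms of the angle,
    up to the factor [i] of [d zeta = i zeta d t]. *)
Definition cauchy_kern (r : R) (z : C) (t : R) : C := (circle r t / (circle r t - z))%C.

Lemma cauchy_kern_cont r z : 0 <= r -> Cmod z < r -> curve_cont (cauchy_kern r z).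
Proof.
intros hr hz t. unfold cauchy_kern.
assert (h : Ccont (X := R_UniformSpace) (circle r) t) by (apply (Ccont_circle r (fun y : R_UniformSpace => y)), continuous_id).
apply Ccont_mult; [exact h|]. apply Ccont_inv; [|apply circle_neq; assumption].
apply Ccont_minus; [exact h|apply Ccont_const].
Qed.

Lemma curve_comp f r : C1_disk f -> 0 <= r < 1 -> curve_cont (fun t => f (circle r t)).
Proof.
intros hf hr t. apply (Ccont_comp (X := R_UniformSpace) f (circle r) t).
- apply C1_cont; [exact hf|]. unfold disk. rewrite Cmod_circle; lra.
- apply (Ccont_circle r (fun y : R_UniformSpace => y)), continuous_id.
Qed.

(** Shrink the circle to [z] along the segments [z + s (zeta - z)].  The
    derivative in [s] of the integral of [f] against the kernel is the integral
    of [f' * zeta], and [s f' i zeta] is the derivative in the angle of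
    [f (z + s (zeta - z))], a periodic function: the integral does not depend
    on [s].  Only the real part is treated; multiplying [f] by [- i] gives the
    imaginary part. *)
Lemma cauchy_re f z r :
  C1_disk f -> Cmod z < r -> r < 1 ->
  RInt (fun t => Re (f (circle r t) * cauchy_kern r z t)%C) 0 (2 * PI) =
  RInt (fun t => Re (f z * cauchy_kern r z t)%C) 0 (2 * PI).
Proof.
intros [f' hf] hz hr1.
assert (z0 := Cmod_ge_0 z). assert (hr : 0 <= r) by lra.
set (pt := fun s t => (z + RtoC s * (circle r t - z))%C).
(* The parameter [s] may leave the interval from 0 to 1 by [d] without the
   contracted circle leaving the disk; an open range is needed to
   differentiate at the end point 1. *)
set (d := (1 - r) / 3). assert (hd : 0 < d) by (unfold d; lra).
assert (inD : forall s, - d < s < 1 + d -> forall t, disk (pt s t)).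
{ intros s hs t. unfold disk, pt.
  replace (z + RtoC s * (circle r t - z))%C with (RtoC (1 - s) * z + RtoC s * circle r t)%C
    by (rewrite RtoC_minus; ring).
  eapply Rle_lt_trans; [apply Cmod_triangle|].
  rewrite !Cmod_mult, !Cmod_R, Cmod_circle by exact hr.
  assert (H1 : Rabs (1 - s) * Cmod z <= Rabs (1 - s) * r).
  { apply Rmult_le_compat_l; [apply Rabs_pos|lra]. }
  assert (H2 : Rabs (1 - s) + Rabs s <= 1 + 2 * d).
  { unfold Rabs. destruct (Rcase_abs (1 - s)), (Rcase_abs s); lra. }
  assert (H3 : (Rabs (1 - s) + Rabs s) * r <= (1 + 2 * d) * r).
  { apply Rmult_le_compat_r; [exact hr|exact H2]. }
  assert (H4 : (1 + 2 * d) * r < 1) by (unfold d; nra).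
  lra. }
set (F := fun s t => Re (f (pt s t) * cauchy_kern r z t)%C).
set (D := fun s t => Re (f' (pt s t) * circle r t)%C).
assert (dF : forall s t, - d < s < 1 + d -> is_derive (fun u => F u t) s (D s t)).
{ intros s t hs.
  destruct (hf _ (inD s hs t)) as [df _].
  assert (A : curve_deriv (fun u => pt u t) s (circle r t - z)%C).
  { replace (circle r t - z)%C with ((circle r t - z) * 1)%C by ring.
    apply (curve_deriv_comp (fun w => z + w * (circle r t - z))%C RtoC);
    [apply Cderiv_affine|apply curve_deriv_RtoC]. }
  assert (B := curve_deriv_comp f (fun u => pt u t) _ _ _ df A).
  assert (E := curve_deriv_comp (fun w => 0 + w * cauchy_kern r z t)%C (fun u => f (pt u t)) _ _ _
     (Cderiv_affine 0 (cauchy_kern r z t) _) B).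
  destruct E as [E _].
  apply (is_derive_ext (V := R_NormedModule) (fun u => Re (0 + f (pt u t) * cauchy_kern r z t)%C)).
  { intros u. unfold F. f_equal. ring. }
  unfold D. replace (f' (pt s t) * circle r t)%C
    with (cauchy_kern r z t * (f' (pt s t) * (circle r t - z)))%C; [exact E|].
  unfold cauchy_kern. field. apply circle_neq; assumption. }
assert (cD : forall s t, - d < s < 1 + d -> continuity_2d_pt D s t).
{ intros s t hs. apply continuity_2d_pt_filterlim.
  destruct (hf _ (inD s hs t)) as [_ cf].
  assert (c1 : Ccont (X := prod_UniformSpace R_UniformSpace R_UniformSpace)
      (fun p => circle r (snd p)) (s, t)).
  { apply (Ccont_circle (X := prod_UniformSpace R_UniformSpace R_UniformSpace) r snd).
    apply continuous_snd. }
  assert (c2 : Ccont (X := prod_UniformSpace R_UniformSpace R_UniformSpace)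
      (fun p => f' (pt (fst p) (snd p)) * circle r (snd p))%C (s, t)).
  { apply Ccont_mult; [|exact c1].
    apply (Ccont_comp (X := prod_UniformSpace R_UniformSpace R_UniformSpace)
       f' (fun p => pt (fst p) (snd p))); [exact cf|].
    unfold pt. apply Ccont_plus; [apply Ccont_const|]. apply Ccont_mult.
    - split; simpl; [apply continuous_fst|apply continuous_const].
    - apply Ccont_minus; [exact c1|apply Ccont_const]. }
  exact (proj1 c2). }
assert (loc : forall s, - d < s < 1 + d -> locally s (fun u => - d < u < 1 + d)).
{ intros s hs. apply (open_and (fun u => - d < u) (fun u => u < 1 + d)).
  - apply open_gt. - apply open_lt. - exact hs. }
assert (intF : forall s, - d < s < 1 + d -> ex_RInt (fun t => F s t) 0 (2 * PI)).
{ intros s hs. apply (curve_ex_RInt_Re (fun t => f (pt s t) * cauchy_kern r z t)%C).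
  intros t. apply Ccont_mult; [|apply cauchy_kern_cont; assumption].
  apply (Ccont_comp (X := R_UniformSpace) f (fun t => pt s t)).
  - eapply Cderiv_cont. apply hf. apply inD, hs.
  - unfold pt. apply Ccont_plus; [apply Ccont_const|]. apply Ccont_mult; [apply Ccont_const|].
    apply Ccont_minus; [|apply Ccont_const].
    apply (Ccont_circle r (fun y : R_UniformSpace => y)), continuous_id. }
assert (dG : forall s, - d < s < 1 + d ->
  is_derive (fun s => RInt (fun t => F s t) 0 (2 * PI)) s (RInt (fun t => D s t) 0 (2 * PI))).
{ intros s hs.
  replace (RInt (fun t => D s t) 0 (2 * PI))
    with (RInt (fun t => Derive (fun u => F u t) s) 0 (2 * PI)).
  2:{ apply RInt_ext. intros t _. apply is_derive_unique, dF, hs. }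
  apply is_derive_RInt_param.
  - generalize (loc s hs). apply filter_imp. intros u hu t _. eexists. apply dF, hu.
  - intros t _. apply continuity_2d_pt_ext_loc with (f := D); [|apply cD, hs].
    destruct (loc s hs) as [e he]. exists e. intros u v hu _.
    symmetry. apply is_derive_unique, dF, he, hu.
  - generalize (loc s hs). apply filter_imp. intros u hu. apply intF, hu. }
assert (zero : forall s, 0 < s < 1 -> RInt (fun t => D s t) 0 (2 * PI) = 0).
{ intros s hs. assert (hs' : - d < s < 1 + d) by lra.
  assert (dt : forall t, curve_deriv (fun t => f (pt s t)) t
      (f' (pt s t) * (RtoC s * (Ci * circle r t)))%C).
  { intros t. apply (curve_deriv_comp f (fun t => pt s t)); [apply hf, inD, hs'|].
    apply (curve_deriv_comp (fun w => z + RtoC s * (w - z))%C (circle r)); [|apply curve_deriv_circle].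
    apply (Cderiv_ext_loc (fun w => (z - RtoC s * z) + w * RtoC s)%C); [|apply Cderiv_affine].
    apply near_all. intros w. ring. }
  assert (cDt : forall t, continuous (fun t => D s t) t).
  { intros t. assert (h := cD s t hs'). apply continuity_2d_pt_filterlim in h.
    apply (continuous_comp (U := R_UniformSpace) (V := prod_UniformSpace R_UniformSpace R_UniformSpace)
      (fun t : R => (s, t)) (fun p => D (fst p) (snd p)) t); [|exact h].
    apply (proj1 (Ccont_continuous (X := R_UniformSpace) (fun t : R => (s, t)) t)).
    split; [apply continuous_const|apply continuous_id]. }
  assert (I : is_RInt (fun t => s * D s t) 0 (2 * PI) (Im (f (pt s (2 * PI))) - Im (f (pt s 0)))).
  { apply (is_RInt_derive (V := R_CompleteNormedModule) (fun t => Im (f (pt s t)))).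
    - intros t _. destruct (dt t) as [_ h].
      replace (s * D s t) with (Im (f' (pt s t) * (RtoC s * (Ci * circle r t)))%C); [exact h|].
      unfold D. generalize (f' (pt s t)), (circle r t). intros [a b] [u v].
      unfold Re, Im; simpl. ring.
    - intros t _. apply (continuous_mult (K := R_AbsRing)); [apply continuous_const|apply cDt]. }
  replace (Im (f (pt s (2 * PI))) - Im (f (pt s 0))) with 0 in I
    by (unfold pt; rewrite circle_period; ring).
  apply (is_RInt_unique (V := R_CompleteNormedModule)) in I.
  rewrite (RInt_scal (V := R_CompleteNormedModule) (fun t => D s t)) in I.
  - change (s * RInt (fun t => D s t) 0 (2 * PI) = 0) in I.
    apply Rmult_integral in I. destruct I; lra.
  - apply (ex_RInt_continuous (V := R_CompleteNormedModule)). intros t _. apply cDt. }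
(* At the end points only continuity is used: the computation of the
   derivative divides by [s]. *)
destruct (MVT_gen (fun s => RInt (fun t => F s t) 0 (2 * PI)) 0 1 (fun _ => 0)) as [c [_ e]].
- rewrite Rmin_left, Rmax_right by lra. intros s hs.
  assert (h := dG s ltac:(lra)). rewrite (zero s hs) in h. exact h.
- rewrite Rmin_left, Rmax_right by lra. intros s hs.
  apply continuity_pt_filterlim.
  apply (ex_derive_continuous (K := R_AbsRing) (V := R_NormedModule)
    (fun s => RInt (fun t => F s t) 0 (2 * PI))).
  eexists. apply dG. lra.
- transitivity (RInt (fun t => F 1 t) 0 (2 * PI)).
  + apply RInt_ext. intros t _. unfold F, pt. do 3 f_equal. ring.
  + transitivity (RInt (fun t => F 0 t) 0 (2 * PI)); [lra|].
    apply RInt_ext. intros t _. unfold F, pt. do 3 f_equal. ring.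
Qed.

Lemma cauchy_kernel f z r :
  C1_disk f -> Cmod z < r -> r < 1 ->
  Cint (fun t => f (circle r t) * cauchy_kern r z t)%C = (f z * Cint (cauchy_kern r z))%C.
Proof.
intros hf hz hr.
assert (hr0 : 0 <= r) by (assert (h := Cmod_ge_0 z); lra).
rewrite <- Cint_scal by (apply cauchy_kern_cont; assumption).
apply C_ext.
- apply (cauchy_re f z r hf hz hr).
- assert (h := cauchy_re (fun w => - Ci * f w)%C z r
    (C1_mult _ _ (C1_const _) hf) hz hr).
  etransitivity; [|etransitivity; [exact h|]]; apply RInt_ext; intros t _;
  generalize (cauchy_kern r z t); intros [u v].
  + destruct (f (circle r t)) as [a b]. unfold Re, Im; simpl; ring.
  + destruct (f z) as [a b]. unfold Re, Im; simpl; ring.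
Qed.

(** The integral giving the coefficient of index [n] of [f], up to [2 pi]. *)
Definition fourier_coef (r : R) (f : C -> C) (n : nat) : C :=
  Cint (fun t => f (circle r t) * (/ circle r t) ^ n)%C.

Lemma circle_nz r t : 0 < r -> circle r t <> 0.
Proof. intros hr e. assert (h := Cmod_circle r t ltac:(lra)). rewrite e, Cmod_0 in h. lra. Qed.

Lemma inv_circle_cont r n : 0 < r -> curve_cont (fun t => (/ circle r t) ^ n)%C.
Proof.
intros hr t. apply Ccont_pow. apply Ccont_inv; [|apply circle_nz, hr].
apply (Ccont_circle r (fun y : R_UniformSpace => y)), continuous_id.
Qed.

(** The kernel [k] satisfies [k = 1 + (z / zeta) k].  Iterating this gives the
    geometric expansion with an explicit remainder, which tends to zero like
    [(|z| / r)^n]. *)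
Lemma kernel_expansion f z r :
  C1_disk f -> Cmod z < r -> r < 1 ->
  Cseries (fun n => fourier_coef r f n * z ^ n)%C (Cint (fun t => f (circle r t) * cauchy_kern r z t)%C).
Proof.
intros hf hz hr1. assert (z0 := Cmod_ge_0 z). assert (hr : 0 < r) by lra.
assert (cf := curve_comp f r hf ltac:(lra)).
assert (ck := cauchy_kern_cont r z ltac:(lra) hz).
set (Rm := fun n => Cint (fun t => (f (circle r t) * cauchy_kern r z t) * (/ circle r t) ^ n)%C).
assert (step : forall n, Rm n = (fourier_coef r f n + z * Rm (S n))%C).
{ intros n. unfold Rm, fourier_coef.
  rewrite <- Cint_scal, <- Cint_plus.
  - apply Cint_ext. intros t. unfold cauchy_kern. simpl Cpow.
    assert (n1 := circle_nz r t hr). assert (n2 := circle_neq r z t ltac:(lra) hz).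
    generalize dependent ((/ circle r t) ^ n)%C. intros X. field. split; assumption.
  - intros t. apply Ccont_mult; [apply cf|apply inv_circle_cont, hr].
  - intros t. apply Ccont_mult; [apply Ccont_const|].
    apply Ccont_mult; [apply Ccont_mult; [apply cf|apply ck]|]. apply (inv_circle_cont r (S n) hr t).
  - intros t. apply Ccont_mult; [apply Ccont_mult; [apply cf|apply ck]|]. apply (inv_circle_cont r (S n) hr t). }
assert (part : forall N, Cint (fun t => f (circle r t) * cauchy_kern r z t)%C =
   (Csum_n (fun n => fourier_coef r f n * z ^ n) N + z ^ (S N) * Rm (S N))%C).
{ induction N as [|N IH].
  - rewrite sum_O. transitivity (Rm O).
    + apply Cint_ext. intros t. simpl. ring.
    + rewrite step. simpl. ring.
  - rewrite IH, sum_Sn, (step (S N)).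
    change (plus ?a ?b) with (Cplus a b). simpl. ring. }
set (K := 2 * RInt (fun t => Cmod (f (circle r t) * cauchy_kern r z t)%C) 0 (2 * PI)).
assert (bd : forall n, Cmod (z ^ n * Rm n) <= (Cmod z / r) ^ n * K).
{ intros n. unfold Rm. rewrite <- Cint_scal.
  2:{ intros t. apply Ccont_mult; [apply Ccont_mult; [apply cf|apply ck]|]. apply (inv_circle_cont r n hr t). }
  assert (cb : forall t : R_UniformSpace, continuous (fun t => Cmod (f (circle r t) * cauchy_kern r z t)%C) t).
  { intros t. apply (Ccont_Cmod (X := R_UniformSpace)). apply Ccont_mult; [apply cf|apply ck]. }
  eapply Rle_trans; [apply (Cint_bound _ (fun t => (Cmod z / r) ^ n * Cmod (f (circle r t) * cauchy_kern r z t)%C))|].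
  - intros t. apply Ccont_mult; [apply Ccont_const|].
    apply Ccont_mult; [apply Ccont_mult; [apply cf|apply ck]|]. apply (inv_circle_cont r n hr t).
  - intros t. apply (continuous_mult (K := R_AbsRing)); [apply continuous_const|apply cb].
  - intros t. rewrite (Cmod_mult _ (_ * _)), (Cmod_mult (_ * cauchy_kern r z t)), !Cmod_pow.
    rewrite Cmod_inv by (apply circle_nz, hr). rewrite Cmod_circle by lra.
    unfold Rdiv. rewrite Rpow_mult_distr. right. ring.
  - rewrite (RInt_scal (V := R_CompleteNormedModule)).
    + unfold K. right. change (scal ?a ?b) with (a * b). ring.
    + apply (ex_RInt_continuous (V := R_CompleteNormedModule)). intros t _. apply cb. }
assert (q : 0 <= Cmod z / r < 1).
{ split; [apply Rdiv_le_0_compat; lra|]. apply (Rdiv_lt_1 _ _ hr). exact hz. }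
apply filterlim_locally. intros eps.
assert (L : is_lim_seq (fun n => (Cmod z / r) ^ (S n) * K) 0).
{ replace (Finite 0) with (Rbar_mult 0 K) by (simpl; f_equal; ring).
  apply (is_lim_seq_scal_r (fun n => (Cmod z / r) ^ (S n)) K 0).
  apply (is_lim_seq_incr_1 (fun n => (Cmod z / r) ^ n)).
  apply is_lim_seq_geom. rewrite Rabs_pos_eq; lra. }
apply is_lim_seq_spec in L. generalize (L eps). apply filter_imp. intros N hN.
apply C_NormedModule_mixin_compat1.
change (minus ?a ?b) with (a - b)%C. rewrite (part N).
match goal with |- Cmod ?x < _ => replace x with (- (z ^ S N * Rm (S N)))%C by ring end.
rewrite Cmod_opp. eapply Rle_lt_trans; [apply bd|].
rewrite Rminus_0_r in hN. eapply Rle_lt_trans; [apply Rle_abs|exact hN].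
Qed.

(** The integrand is, up to the factor [- i n], its own derivative, and it is
    periodic. *)
Lemma Cint_inv_pow r n : 0 < r -> Cint (fun t => (/ circle r t) ^ S n)%C = 0.
Proof.
intros hr.
assert (dt : forall t, curve_deriv (fun t => (/ circle r t) ^ S n)%C t
   (- (RtoC (INR (S n)) * (Ci * (/ circle r t) ^ S n)))%C).
{ intros t. assert (nz := circle_nz r t hr).
  assert (A := curve_deriv_comp _ (circle r) t _ _
    (Cderiv_comp _ (fun w => / w)%C _ _ _ (Cderiv_pow n _)
        (Cderiv_inv _ _ _ (Cderiv_id (circle r t)) nz)) (curve_deriv_circle r t)).
  match type of A with curve_deriv _ _ ?x => replace (- (RtoC (INR (S n)) * (Ci * (/ circle r t) ^ S n)))%C
    with x end; [exact A|].
  simpl Cpow. generalize ((/ circle r t) ^ n)%C. intros X. field. exact nz. }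
assert (c : curve_cont (fun t => (/ circle r t) ^ S n)%C) by (apply inv_circle_cont, hr).
assert (nn : INR (S n) <> 0) by (apply not_0_INR; lia).
apply C_ext.
- assert (I : is_RInt (fun t => scal (INR (S n)) (Re ((/ circle r t) ^ S n)%C)) 0 (2 * PI)
     (- Im ((/ circle r (2 * PI)) ^ S n)%C - - Im ((/ circle r 0) ^ S n)%C)).
  { apply (is_RInt_derive (V := R_CompleteNormedModule) (fun t => - Im ((/ circle r t) ^ S n)%C)).
    - intros t _. destruct (dt t) as [_ h]. apply (is_derive_opp (V := R_NormedModule)) in h.
      match type of h with is_derive _ _ ?x => replace (scal (INR (S n)) (Re ((/ circle r t) ^ S n)%C))
        with x end; [exact h|].
      generalize ((/ circle r t) ^ S n)%C, (INR (S n)). intros [u v] m.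
      unfold Re, Im, scal, opp; simpl. unfold mult; simpl. ring.
    - intros t _. apply (continuous_scal_r (V := R_NormedModule)). exact (proj1 (c t)). }
  rewrite circle_period in I.
  match type of I with is_RInt _ _ _ ?x => replace x with 0 in I by ring end.
  apply (is_RInt_unique (V := R_CompleteNormedModule)) in I.
  rewrite (RInt_scal (V := R_CompleteNormedModule)) in I by (apply (curve_ex_RInt_Re _ c)).
  apply Rmult_integral in I. destruct I as [I|I]; [contradiction|exact I].
- assert (I : is_RInt (fun t => scal (INR (S n)) (Im ((/ circle r t) ^ S n)%C)) 0 (2 * PI)
     (Re ((/ circle r (2 * PI)) ^ S n)%C - Re ((/ circle r 0) ^ S n)%C)).
  { apply (is_RInt_derive (V := R_CompleteNormedModule) (fun t => Re ((/ circle r t) ^ S n)%C)).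
    - intros t _. destruct (dt t) as [h _].
      match type of h with is_derive _ _ ?x => replace (scal (INR (S n)) (Im ((/ circle r t) ^ S n)%C))
        with x end; [exact h|].
      generalize ((/ circle r t) ^ S n)%C, (INR (S n)). intros [u v] m.
      unfold Re, Im, scal, opp; simpl. unfold mult; simpl. ring.
    - intros t _. apply (continuous_scal_r (V := R_NormedModule)). exact (proj2 (c t)). }
  rewrite circle_period in I.
  match type of I with is_RInt _ _ _ ?x => replace x with 0 in I by ring end.
  apply (is_RInt_unique (V := R_CompleteNormedModule)) in I.
  rewrite (RInt_scal (V := R_CompleteNormedModule)) in I by (apply (curve_ex_RInt_Im _ c)).
  apply Rmult_integral in I. destruct I as [I|I]; [contradiction|exact I].
Qed.

(** The expansion of the kernel for the function 1 has a single nonzero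
    term. *)
Lemma Cint_cauchy_kern r z : Cmod z < r -> r < 1 -> Cint (cauchy_kern r z) = RtoC (2 * PI).
Proof.
intros hz hr1. assert (hr : 0 < r) by (assert (h := Cmod_ge_0 z); lra).
assert (K := kernel_expansion (fun _ => RtoC 1) z r (C1_const _) hz hr1).
replace (Cint (cauchy_kern r z)) with (Cint (fun t => RtoC 1 * cauchy_kern r z t)%C)
  by (apply Cint_ext; intros t; ring).
apply (Cseries_unique _ _ _ K).
assert (f0 : fourier_coef r (fun _ => RtoC 1) 0 = RtoC (2 * PI)).
{ unfold fourier_coef. rewrite (Cint_ext _ (fun _ => RtoC 1)) by (intros t; simpl; ring).
  unfold Cint; simpl. rewrite !RInt_const. 
  unfold scal; simpl; unfold mult; simpl. unfold RtoC. f_equal; ring. }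
apply Cseries_cons. rewrite f0.
replace (RtoC (2 * PI) - RtoC (2 * PI) * z ^ 0)%C with (RtoC 0) by (simpl; ring).
apply (Cseries_ext (fun _ => RtoC 0)); [|apply Cseries_zero].
intros n. unfold fourier_coef.
rewrite (Cint_ext _ (fun t => (/ circle r t) ^ S n)%C) by (intros t; ring).
rewrite Cint_inv_pow by exact hr. ring.
Qed.

Lemma twoPI_nz : RtoC (2 * PI) <> 0.
Proof. intros e. apply RtoC_inj in e. assert (h := PI_RGT_0). lra. Qed.

Theorem cauchy_formula f z r :
  C1_disk f -> Cmod z < r -> r < 1 ->
  f z = (/ RtoC (2 * PI) * Cint (fun t => f (circle r t) * cauchy_kern r z t))%C.
Proof.
intros hf hz hr. rewrite cauchy_kernel, Cint_cauchy_kern by assumption.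
field. apply twoPI_nz.
Qed.

(** Cauchy's formula expands [f] on every smaller disk; the coefficients agree
    by uniqueness on the disk of radius 1/2. *)
Theorem C1_power_series f : C1_disk f -> exists a, power_series_on 1 a f.
Proof.
intros hf.
set (A := fun r n => (/ RtoC (2 * PI) * fourier_coef r f n)%C).
assert (P : forall r, 0 < r < 1 -> power_series_on r (A r) f).
{ intros r hr z hz. rewrite (cauchy_formula f z r) by (try assumption; lra).
  apply (Cseries_ext (fun n => / RtoC (2 * PI) * (fourier_coef r f n * z ^ n))%C).
  - intros n. unfold A. ring.
  - apply Cseries_scal. apply kernel_expansion; try assumption; lra. }
exists (A (1 / 2)). intros z hz. assert (z0 := Cmod_ge_0 z).
set (r := (1 + Rmax (Cmod z) (1 / 2)) / 2).
assert (h1 := Rmax_l (Cmod z) (1 / 2)). assert (h2 := Rmax_r (Cmod z) (1 / 2)).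
assert (h3 : Rmax (Cmod z) (1 / 2) < 1) by (apply Rmax_lub_lt; lra).
assert (hr : 1 / 2 < r < 1 /\ Cmod z < r) by (unfold r; lra).
apply (Cseries_ext (fun n => A r n * z ^ n)%C); [|apply P; lra].
intros n. f_equal. apply (power_series_unique (1 / 2) _ _ f); [lra| |apply P; lra].
intros w hw. apply P; lra.
Qed.

(** * Disk automorphisms *)

Lemma Cmod_sqr_alt z : Cmod z ^ 2 = Re z * Re z + Im z * Im z.
Proof. rewrite Cmod2_alt. ring. Qed.

Lemma disk_sqr z : disk z <-> Re z * Re z + Im z * Im z < 1.
Proof.
unfold disk. rewrite <- Cmod_sqr_alt. assert (h := Cmod_ge_0 z). split; intros; nra.
Qed.

Lemma alpha_den p z : disk p -> disk z -> (1 - Cconj p * z)%C <> 0.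
Proof.
unfold disk. intros hp hz e.
assert (e' : (Cconj p * z)%C = 1).
{ replace (Cconj p * z)%C with (1 - (1 - Cconj p * z))%C by ring. rewrite e. ring. }
assert (h : Cmod (Cconj p * z) = 1) by (rewrite e'; apply Cmod_1).
rewrite Cmod_mult, Cmod_conj in h.
assert (h1 := Cmod_ge_0 p). assert (h2 := Cmod_ge_0 z). nra.
Qed.

(** This is [|1 - conj p z|^2 - |p - z|^2 = (1 - |p|^2) (1 - |z|^2) > 0]. *)
Lemma alpha_disk p z : disk p -> disk z -> disk (alpha p z).
Proof.
intros hp hz. assert (nz := alpha_den p z hp hz).
unfold disk, alpha. rewrite Cmod_div by exact nz.
apply Cmod_gt_0 in nz. apply (Rdiv_lt_1 _ _ nz).
assert (h0 := Cmod_ge_0 (p - z)).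
assert (h : Cmod (p - z) ^ 2 < Cmod (1 - Cconj p * z) ^ 2).
{ rewrite !Cmod_sqr_alt. apply disk_sqr in hp. apply disk_sqr in hz.
  destruct p as [a b], z as [x y]. unfold Re, Im in *; simpl in *. nra. }
nra.
Qed.

Lemma alpha_involutive p z : disk p -> disk z -> alpha p (alpha p z) = z.
Proof.
intros hp hz. assert (nz := alpha_den p z hp hz).
assert (n2 := alpha_den p p hp hp).
unfold alpha. field. split; [exact nz|].
intros e. apply n2. 
rewrite <- e. ring.
Qed.

Lemma alpha_self p : alpha p p = 0.
Proof. unfold alpha. replace (p - p)%C with (RtoC 0) by ring. unfold Cdiv. ring. Qed.

Lemma alpha_at_0 p : alpha p 0 = p.
Proof. unfold alpha. replace (1 - Cconj p * 0)%C with (RtoC 1) by ring. field. Qed.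

Lemma disk_0 : disk 0.
Proof. unfold disk. rewrite Cmod_0. lra. Qed.

Lemma disk_opp z : disk z -> disk (- z).
Proof. unfold disk. rewrite Cmod_opp. trivial. Qed.

Lemma alpha_C1 p : disk p -> C1_disk (alpha p).
Proof.
intros hp. unfold alpha. apply C1_div.
- apply C1_minus; [apply C1_const|apply C1_id].
- apply C1_minus; [apply C1_const|]. apply C1_mult; [apply C1_const|apply C1_id].
- intros z. apply alpha_den, hp.
Qed.

(** * Zeros of holomorphic functions *)

(** [alpha w] carries the zero to the centre, and the composite is again a
    power series on the whole disk.  This replaces both the re-expansion of
    [f] at [w] and the usual connectedness argument. *)
Lemma zero_isolated f w :
  C1_disk f -> disk w -> f w = 0 ->
  eq_on_disk f (fun _ => RtoC 0) \/ near w (fun z => z <> w -> f z <> 0).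
Proof.
intros hf hw fw.
assert (hg : C1_disk (fun z => f (alpha w z))).
{ apply C1_comp; [exact hf|apply alpha_C1, hw|]. intros z. apply alpha_disk, hw. }
destruct (C1_power_series _ hg) as [a ha].
destruct (power_series_zero_isolated 1 a _ Rlt_0_1 ha) as [e|e].
- left. intros z hz. rewrite <- (alpha_involutive w z hw hz).
  apply (Cseries_unique (fun n => a n * alpha w z ^ n)%C).
  + apply ha. apply alpha_disk; assumption.
  + apply (Cseries_ext (fun _ => RtoC 0)); [|apply Cseries_zero].
    intros n. rewrite e. ring.
- right.
  assert (c : Ccont_at (alpha w) w) by (apply C1_cont; [apply alpha_C1|]; exact hw).
  assert (e' : near (alpha w w) (fun z => z <> 0 -> f (alpha w z) <> 0))
    by (rewrite alpha_self; exact e).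
  generalize (filter_and _ _ (near_disk w hw) (Ccont_at_near _ _ _ c e')). apply filter_imp.
  intros z [hz h] ne. rewrite <- (alpha_involutive w z hw hz). apply h.
  intros e0. apply ne. rewrite <- (alpha_involutive w z hw hz), e0.
  apply alpha_at_0.
Qed.

Lemma identity_principle f w :
  C1_disk f -> disk w -> near w (fun z => f z = 0) -> eq_on_disk f (fun _ => RtoC 0).
Proof.
intros hf hw h. destruct (zero_isolated f w hf hw (near_self _ _ h)) as [e|e]; [exact e|].
destruct (near_other _ _ (filter_and _ _ h e)) as [z [ne [z0 z1]]].
exfalso. exact (z1 ne z0).
Qed.

(** If [f w <> 0] then [f] has no zero near [w], so [g] vanishes there. *)
Lemma C1_integral f g :
  C1_disk f -> C1_disk g -> eq_on_disk (fun z => f z * g z)%C (fun _ => RtoC 0) ->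
  eq_on_disk f (fun _ => RtoC 0) \/ eq_on_disk g (fun _ => RtoC 0).
Proof.
intros hf hg h.
destruct (classic (eq_on_disk f (fun _ => RtoC 0))) as [e|ne]; [left; exact e|right].
apply not_all_ex_not in ne. destruct ne as [w nw]. apply imply_to_and in nw.
destruct nw as [dw nw].
apply (identity_principle g w hg dw).
generalize (filter_and _ _ (near_disk w dw) (Ccont_at_neq0 f w (C1_cont f w hf dw) nw)).
apply filter_imp. intros z [dz nz]. specialize (h z dz). cbv beta in h.
apply NNPP. intros ng. exact (Cmult_neq_0 _ _ nz ng h).
Qed.

(** * The maximum principle and the Schwarz lemma *)

Lemma pow_dominated x M C0 :
  0 <= M -> (forall n, x ^ n <= C0 * M ^ n) -> x <= M.
Proof.
intros hM h. apply Rnot_lt_le. intros lt.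
destruct (Req_dec M 0) as [->|nz].
- specialize (h 1%nat). simpl in h. lra.
- assert (M0 : 0 < M) by lra.
  assert (q : 1 < x / M) by (apply (Rlt_div_r 1 x M M0); lra).
  destruct (Pow_x_infinity (x / M) ltac:(rewrite Rabs_pos_eq; lra) (C0 + 1)) as [N hN].
  specialize (hN N (Nat.le_refl N)).
  rewrite Rabs_pos_eq in hN by (apply pow_le; lra).
  specialize (h N). assert (p : 0 < M ^ N) by (apply pow_lt, M0).
  assert (e : x ^ N = (x / M) ^ N * M ^ N).
  { rewrite <- Rpow_mult_distr. f_equal. field. lra. }
  rewrite e in h. apply Rmult_le_reg_r in h; [lra|exact p].
Qed.

(** Cauchy's formula gives the bound only up to a constant depending on [z] and
    [r].  Applied to the powers of [f] it gives [|f z|^n <= C M^n] for all [n],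
    which removes the constant. *)
Lemma max_modulus f z r M :
  C1_disk f -> Cmod z < r -> r < 1 -> 0 <= M ->
  (forall t, Cmod (f (circle r t)) <= M) -> Cmod (f z) <= M.
Proof.
intros hf hz hr hM h. assert (z0 := Cmod_ge_0 z).
set (K := RInt (fun t => Cmod (cauchy_kern r z t)) 0 (2 * PI)).
assert (ck := cauchy_kern_cont r z ltac:(lra) hz).
assert (cb : forall t : R_UniformSpace, continuous (fun t => Cmod (cauchy_kern r z t)) t).
{ intros t. apply (Ccont_Cmod (X := R_UniformSpace)), ck. }
apply (pow_dominated _ _ (Cmod (/ RtoC (2 * PI)) * (2 * K))); [exact hM|].
intros n. rewrite <- Cmod_pow.
assert (hn := C1_pow f n hf).
rewrite (cauchy_formula (fun z => f z ^ n)%C z r hn hz hr).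
rewrite Cmod_mult, Rmult_assoc. apply Rmult_le_compat_l; [apply Cmod_ge_0|].
eapply Rle_trans; [apply (Cint_bound _ (fun t => M ^ n * Cmod (cauchy_kern r z t)))|].
- intros t. apply Ccont_mult; [|apply ck]. apply (curve_comp (fun z => f z ^ n)%C r hn). lra.
- intros t. apply (continuous_mult (K := R_AbsRing)); [apply continuous_const|apply cb].
- intros t. rewrite Cmod_mult, Cmod_pow. apply Rmult_le_compat_r; [apply Cmod_ge_0|].
  apply pow_incr. split; [apply Cmod_ge_0|apply h].
- rewrite (RInt_scal (V := R_CompleteNormedModule)).
  + unfold K. right. change (scal ?a ?b) with (a * b). ring.
  + apply (ex_RInt_continuous (V := R_CompleteNormedModule)). intros t _. apply cb.
Qed.

Lemma divide_by_id G :
  C1_disk G -> G 0 = 0 -> exists Q, C1_disk Q /\ forall z, disk z -> G z = (z * Q z)%C.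
Proof.
intros hG G0. destruct (C1_power_series _ hG) as [a ha].
assert (a0 : a O = 0).
{ rewrite <- G0. apply (Cseries_unique _ _ _ (Cseries_at_0 a)). apply ha, disk_0. }
destruct (power_series_exists 1 (fun n => a (S n))) as [Q hQ].
{ intros z hz. destruct (Ceq_dec z 0) as [->|nz].
  - exists (a 1%nat). apply (Cseries_at_0 (fun n => a (S n))).
  - exists (/ z * (G z - a O * z ^ 0))%C.
    apply (Cseries_ext (fun n => / z * (a (S n) * z ^ S n))%C).
    + intros n. simpl. field. exact nz.
    + apply Cseries_scal. apply (Cseries_tail (fun n => a n * z ^ n)%C), ha, hz. }
exists Q. split; [eapply power_series_C1, hQ|].
intros z hz. apply (Cseries_unique (fun n => a n * z ^ n)%C); [apply ha, hz|].
apply Cseries_cons. rewrite a0.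
replace (z * Q z - 0 * z ^ 0)%C with (z * Q z)%C by ring.
apply (Cseries_ext (fun n => z * (a (S n) * z ^ n))%C); [intros n; simpl; ring|].
apply Cseries_scal, hQ, hz.
Qed.

(** On the circle of radius [r] the quotient [Q] is bounded by [1 / r]; apply
    the maximum principle and let [r] tend to 1. *)
Lemma schwarz_quotient G Q :
  C1_disk Q -> (forall z, disk z -> disk (G z)) ->
  (forall z, disk z -> G z = (z * Q z)%C) ->
  forall z, disk z -> Cmod (Q z) <= 1.
Proof.
intros hQ dG e z hz. unfold disk in hz. assert (z0 := Cmod_ge_0 z).
assert (H : forall r, Cmod z < r < 1 -> Cmod (Q z) * r <= 1).
{ intros r hr.
  assert (b : Cmod (Q z) <= / r).
  { apply (max_modulus Q z r); try lra; [exact hQ|left; apply Rinv_0_lt_compat; lra|].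
    intros t. assert (dt : disk (circle r t)) by (unfold disk; rewrite Cmod_circle; lra).
    assert (g := dG _ dt). rewrite e in g by exact dt. unfold disk in g.
    rewrite Cmod_mult, Cmod_circle in g by lra.
    apply Rmult_le_reg_l with r; [lra|]. rewrite Rinv_r by lra. lra. }
  apply Rmult_le_compat_r with (r := r) in b; [|lra]. rewrite Rinv_l in b by lra. exact b. }
apply Rnot_lt_le. intros lt.
(* The radius half way between [m] and 1 exceeds both [|z|] and
   [1 / |Q z|]. *)
set (m := Rmax (Cmod z) (/ Cmod (Q z))).
assert (i : / Cmod (Q z) < 1) by (rewrite <- Rinv_1; apply Rinv_lt_contravar; lra).
assert (m1 : m < 1) by (apply Rmax_lub_lt; lra).
assert (ml := Rmax_l (Cmod z) (/ Cmod (Q z))). assert (mr := Rmax_r (Cmod z) (/ Cmod (Q z))).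
fold m in ml, mr.
specialize (H ((m + 1) / 2) ltac:(lra)).
assert (k : Cmod (Q z) * / Cmod (Q z) < Cmod (Q z) * ((m + 1) / 2)) by (apply Rmult_lt_compat_l; lra).
rewrite Rinv_r in k by lra. lra.
Qed.

Lemma curve_deriv_ray f l z t :
  Cderiv f (RtoC t * z)%C l -> curve_deriv (fun s => f (RtoC s * z)%C) t (l * z)%C.
Proof.
intros h. apply (curve_deriv_comp f (fun s => RtoC s * z)%C); [exact h|].
assert (k : curve_deriv (fun s => RtoC s * z)%C t (z * 1)%C).
{ apply (curve_deriv_comp (fun w => w * z)%C RtoC); [|apply curve_deriv_RtoC].
  apply (Cderiv_ext_loc (fun w => 0 + w * z)%C); [|apply Cderiv_affine].
  apply near_all. intros w. ring. }
replace (z * 1)%C with z in k by ring. exact k.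
Qed.

Lemma ray_disk t z : 0 <= t <= 1 -> disk z -> disk (RtoC t * z).
Proof.
unfold disk. intros ht hz. rewrite Cmod_mult, Cmod_R, Rabs_pos_eq by lra.
assert (h := Cmod_ge_0 z). nra.
Qed.

Lemma curve_deriv_zero_const g : (forall t, 0 <= t <= 1 -> curve_deriv g t 0) -> g 0 = g 1.
Proof.
intros h. apply C_ext.
- apply (eq_is_derive (V := R_NormedModule) (fun t => Re (g t)) 0 1); [|lra].
  intros t ht. apply h, ht.
- apply (eq_is_derive (V := R_NormedModule) (fun t => Im (g t)) 0 1); [|lra].
  intros t ht. apply h, ht.
Qed.

Lemma zero_derivative f :
  (forall z, disk z -> Cderiv f z 0) -> forall z, disk z -> f z = f 0.
Proof.
intros h z hz.
assert (e := curve_deriv_zero_const (fun s => f (RtoC s * z)%C)).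
cbv beta in e. replace (0 * z)%C with (RtoC 0) in e by ring.
replace (1 * z)%C with z in e by ring. symmetry. apply e.
intros t ht. replace (RtoC 0) with (0 * z)%C by ring. apply curve_deriv_ray, h, ray_disk; assumption.
Qed.

(** The derivative of [|Q|^2] in the direction [v] is twice the inner product
    of [Q] and [Q' v].  If [Q' z <> 0], the direction [v = Q z / Q' z] makes it
    [2 |Q z|^2], although [|Q|^2] is constant. *)
Lemma unimodular_const Q :
  C1_disk Q -> (forall z, disk z -> Cmod (Q z) = 1) -> forall z, disk z -> Q z = Q 0.
Proof.
intros [Q' h] u. apply zero_derivative. intros z hz.
destruct (h z hz) as [d _].
destruct (Ceq_dec (Q' z) 0) as [<-|nz]; [exact d|exfalso].
set (v := (Q z / Q' z)%C).
assert (A : curve_deriv (fun s => Q (z + RtoC s * v)%C) 0 (Q z)).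
{ replace (Q z) with (Q' z * (v * 1))%C by (unfold v; field; exact nz).
  apply (curve_deriv_comp Q (fun s => z + RtoC s * v)%C).
  - replace (z + 0 * v)%C with z by ring. exact d.
  - apply (curve_deriv_comp (fun w => z + w * v)%C RtoC); [apply Cderiv_affine|apply curve_deriv_RtoC]. }
assert (cl : Ccont (X := R_UniformSpace) (fun s => z + RtoC s * v)%C 0).
{ apply Ccont_plus; [apply Ccont_const|]. apply Ccont_mult; [|apply Ccont_const].
  apply (curve_deriv_cont RtoC 0 1), curve_deriv_RtoC. }
apply Ccont_continuous in cl.
assert (N : @locally R_UniformSpace 0 (fun s => disk (z + RtoC s * v))).
{ apply cl. replace (z + 0 * v)%C with z by ring. apply near_disk, hz. }
destruct A as [a b].
assert (E : is_derive (fun s => Re (Q (z + RtoC s * v)%C) ^ 2 + Im (Q (z + RtoC s * v)%C) ^ 2) 0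
   (2 * Re (Q z) * Re (Q z) + 2 * Im (Q z) * Im (Q z))).
{ apply (is_derive_plus (V := R_NormedModule)).
  - replace (2 * Re (Q z) * Re (Q z)) with (INR 2 * Re (Q z) * Re (Q (z + RtoC 0 * v)%C) ^ pred 2).
    + apply is_derive_pow, a.
    + replace (z + 0 * v)%C with z by ring. simpl. ring.
  - replace (2 * Im (Q z) * Im (Q z)) with (INR 2 * Im (Q z) * Im (Q (z + RtoC 0 * v)%C) ^ pred 2).
    + apply is_derive_pow, b.
    + replace (z + 0 * v)%C with z by ring. simpl. ring. }
assert (E0 : is_derive (fun s => Re (Q (z + RtoC s * v)%C) ^ 2 + Im (Q (z + RtoC s * v)%C) ^ 2) 0 0).
{ apply (is_derive_ext_loc (V := R_NormedModule) (fun _ => 1)).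
  - revert N. apply filter_imp. intros s hs. rewrite <- Cmod2_alt, (u _ hs). to_R_eq. ring.
  - apply (is_derive_const (V := R_NormedModule)). }
apply is_derive_unique in E. apply is_derive_unique in E0. rewrite E in E0.
assert (k := Cmod_sqr_alt (Q z)). rewrite (u z hz) in k. lra.
Qed.

(** Schwarz' lemma for both maps gives [|z| = |H (G z)| <= |G z| <= |z|], so
    [G z / z] has modulus 1, and such a function is constant. *)
Lemma schwarz_automorphism G H :
  C1_disk G -> C1_disk H ->
  (forall z, disk z -> disk (G z)) -> (forall z, disk z -> disk (H z)) ->
  G 0 = 0 -> H 0 = 0 -> (forall z, disk z -> H (G z) = z) ->
  exists lam, forall z, disk z -> G z = (lam * z)%C.
Proof.
intros hG hH dG dH G0 H0 inv.
destruct (divide_by_id G hG G0) as [Q [hQ eQ]].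
destruct (divide_by_id H hH H0) as [P [hP eP]].
assert (bQ := schwarz_quotient G Q hQ dG eQ).
assert (bP := schwarz_quotient H P hP dH eP).
assert (u : forall z, disk z -> z <> 0 -> Cmod (Q z) = 1).
{ intros z hz nz. apply Rle_antisym; [apply bQ, hz|].
  assert (e := inv z hz). rewrite (eP _ (dG z hz)), (eQ z hz) in e.
  assert (e' : Cmod (Q z) * Cmod (P (z * Q z)%C) = 1).
  { apply Cmod_gt_0 in nz. apply Rmult_eq_reg_l with (Cmod z); [|lra].
    apply (f_equal Cmod) in e. rewrite (Cmod_mult (z * Q z)), (Cmod_mult z) in e. lra. }
  assert (b := bP _ (dG z hz)). rewrite (eQ z hz) in b.
  assert (h1 := Cmod_ge_0 (Q z)). nra. }
assert (u0 : Cmod (Q 0) = 1).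
{ assert (c := C1_cont Q 0 hQ disk_0). apply (Ccont_Cmod (X := C_UniformSpace)) in c.
  apply NNPP. intros ne.
  assert (p : 0 < Rabs (Cmod (Q 0) - 1)) by (apply Rabs_pos_lt; lra).
  assert (L := proj1 (filterlim_locally _ _) c (mkposreal _ p)).
  destruct (near_other _ _ (filter_and _ _ (near_disk 0 disk_0) L)) as [w [nw [dw hw]]].
  change (Rabs (Cmod (Q w) - Cmod (Q 0)) < Rabs (Cmod (Q 0) - 1)) in hw.
  rewrite (u w dw nw), Rabs_minus_sym in hw. lra. }
exists (Q 0). intros z hz. rewrite (eQ z hz).
rewrite (unimodular_const Q hQ); [ring| |exact hz].
intros w hw. destruct (Ceq_dec w 0) as [e|nw]; [rewrite e; exact u0|apply u; assumption].
Qed.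

(** * Exponentials of odd functions *)

Lemma curve_deriv_mult g h t l m :
  curve_deriv g t l -> curve_deriv h t m -> curve_deriv (fun s => g s * h s)%C t (l * h t + g t * m)%C.
Proof.
intros [a b] [c d].
assert (e1 := is_derive_mult (K := R_AbsRing) _ _ _ _ _ a c Rmult_comm).
assert (e2 := is_derive_mult (K := R_AbsRing) _ _ _ _ _ b d Rmult_comm).
assert (e3 := is_derive_mult (K := R_AbsRing) _ _ _ _ _ a d Rmult_comm).
assert (e4 := is_derive_mult (K := R_AbsRing) _ _ _ _ _ b c Rmult_comm).
split.
- assert (E := is_derive_minus (V := R_NormedModule) _ _ _ _ _ e1 e2).
  match type of E with is_derive _ _ ?x => replace (Re (l * h t + g t * m)%C) with x end.
  + revert E. apply (is_derive_ext (V := R_NormedModule)). intros s. rewrite re_mult. reflexivity.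
  + rewrite re_plus, !re_mult. unfold minus, plus, opp, mult; simpl. unfold mult; simpl. ring.
- assert (E := is_derive_plus (V := R_NormedModule) _ _ _ _ _ e3 e4).
  match type of E with is_derive _ _ ?x => replace (Im (l * h t + g t * m)%C) with x end.
  + revert E. apply (is_derive_ext (V := R_NormedModule)). intros s. rewrite im_mult. reflexivity.
  + rewrite im_plus, !im_mult. unfold plus, mult; simpl. unfold mult; simpl. ring.
Qed.

Lemma Re_Cexp z : Re (Cexp z) = exp (Re z) * cos (Im z).
Proof. unfold Cexp, Re, Im; simpl. ring. Qed.

Lemma Im_Cexp z : Im (Cexp z) = exp (Re z) * sin (Im z).
Proof. unfold Cexp, Re, Im; simpl. ring. Qed.

Lemma is_derive_exp_cos (u v : R -> R) t a b : is_derive u t a -> is_derive v t b ->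
  is_derive (fun s => exp (u s) * cos (v s)) t
    (exp (u t) * cos (v t) * a - exp (u t) * sin (v t) * b).
Proof.
intros hu hv. auto_derive.
- split; [eexists; exact hu|split; [eexists; exact hv|trivial]].
- replace (Derive (fun x => u x) t) with a by (symmetry; apply is_derive_unique, hu).
  replace (Derive (fun x => v x) t) with b by (symmetry; apply is_derive_unique, hv). ring.
Qed.

Lemma is_derive_exp_sin (u v : R -> R) t a b : is_derive u t a -> is_derive v t b ->
  is_derive (fun s => exp (u s) * sin (v s)) t
    (exp (u t) * cos (v t) * b + exp (u t) * sin (v t) * a).
Proof.
intros hu hv. auto_derive.
- split; [eexists; exact hu|split; [eexists; exact hv|trivial]].
- replace (Derive (fun x => u x) t) with a by (symmetry; apply is_derive_unique, hu).
  replace (Derive (fun x => v x) t) with b by (symmetry; apply is_derive_unique, hv). ring.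
Qed.

Lemma curve_deriv_Cexp g t l : curve_deriv g t l -> curve_deriv (fun s => Cexp (g s)) t (Cexp (g t) * l)%C.
Proof.
intros [a b]. split.
- rewrite re_mult, Re_Cexp, Im_Cexp.
  apply (is_derive_ext (V := R_NormedModule) (fun s => exp (Re (g s)) * cos (Im (g s)))).
  + intros s. rewrite Re_Cexp. reflexivity.
  + apply is_derive_exp_cos; assumption.
- rewrite im_mult, Re_Cexp, Im_Cexp.
  apply (is_derive_ext (V := R_NormedModule) (fun s => exp (Re (g s)) * sin (Im (g s)))).
  + intros s. rewrite Im_Cexp. reflexivity.
  + apply is_derive_exp_sin; assumption.
Qed.

Lemma Cexp_opp z : (Cexp (- z) * Cexp z)%C = 1.
Proof.
apply C_ext; rewrite ?re_mult, ?im_mult, !Re_Cexp, !Im_Cexp, re_opp, im_opp, cos_neg, sin_neg, exp_Ropp;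
assert (h := exp_pos (Re z)); assert (k := sin2_cos2 (Im z)); unfold Rsqr in k; simpl.
- field_simplify; [|lra]. 
  replace (cos (Im z) ^ 2 + sin (Im z) ^ 2) with 1 by (rewrite <- k; ring). ring.
- field. lra.
Qed.

Lemma Cexp_0 : Cexp 0 = 1.
Proof. apply C_ext; rewrite ?Re_Cexp, ?Im_Cexp; simpl; rewrite exp_0, ?cos_0, ?sin_0; ring. Qed.

(** Termwise integration; an even function has only even powers by uniqueness
    of the coefficients, so its primitive has only odd ones. *)
Lemma even_antiderivative b L :
  power_series_on 1 b L -> (forall z, disk z -> L (- z)%C = L z) ->
  exists (a : nat -> C) (h : C -> C),
    power_series_on 1 a h /\ (forall z, disk z -> Cderiv h z (L z)) /\ a O = 0 /\
    (forall k, a (2 * k)%nat = 0).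
Proof.
intros hb ev.
assert (odd : forall k, b (2 * k + 1)%nat = 0).
{ intros k.
  assert (hb' : power_series_on 1 (fun n => (- (1)) ^ n * b n)%C L).
  { intros z hz. rewrite <- (ev z hz).
    apply (Cseries_ext (fun n => b n * (- z) ^ n)%C).
    - intros n. replace (- z)%C with (- (1) * z)%C by ring. rewrite Cpow_mult_l. ring.
    - apply hb. rewrite Cmod_opp. exact hz. }
  assert (e := power_series_unique 1 _ _ L Rlt_0_1 hb' hb (2 * k + 1)%nat). cbv beta in e.
  rewrite Cpow_add_r, Cpow_mult_r, Cpow_1_r in e.
  replace ((- (1)) ^ 2)%C with (RtoC 1) in e by (simpl; ring).
  rewrite Cpow_1_l in e.
  replace (b (2 * k + 1)%nat) with (/ 2 * (b (2 * k + 1)%nat - 1 * - (1) * b (2 * k + 1)%nat))%C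
    by (simpl; field; intros h; apply RtoC_inj in h; lra).
  rewrite e. ring. }
set (a := fun n => match n with O => RtoC 0 | S m => (b m / RtoC (INR (S m)))%C end).
assert (nz : forall m, RtoC (INR (S m)) <> 0).
{ intros m e. apply RtoC_inj in e. revert e. apply not_0_INR. lia. }
destruct (power_series_exists 1 a) as [h hh].
{ intros z hz.
  assert (z0 := Cmod_ge_0 z).
  apply (Cseries_le _ (fun n => match n with O => 0 | S m => Cmod (b m) * Cmod z ^ m end)).
  - intros [|m].
    + unfold a. rewrite Cmult_0_l, Cmod_0. lra.
    + change (a (S m)) with (b m / RtoC (INR (S m)))%C. rewrite Cmod_mult, Cmod_div, Cmod_pow by apply nz.
      assert (m1 : 1 <= INR (S m)) by (rewrite S_INR; assert (h := pos_INR m); lra).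
      rewrite Cmod_R, Rabs_pos_eq by lra.
      assert (A : Cmod (b m) / INR (S m) <= Cmod (b m)).
      { apply Rle_div_l; [lra|]. assert (h := Cmod_ge_0 (b m)). nra. }
      assert (B : Cmod z ^ S m <= Cmod z ^ m).
      { simpl. assert (h := pow_le (Cmod z) m z0). nra. }
      apply Rmult_le_compat; try assumption.
      * apply Rdiv_le_0_compat; [apply Cmod_ge_0|lra].
      * apply pow_le, z0.
  - apply ex_series_incr_1.
    apply ex_series_radius; [intros n; apply Cmod_ge_0|exact z0|].
    eapply power_series_radius; [exact hb|]. lra. }
exists a, h. split; [exact hh|split; [|split; [reflexivity|]]].
- destruct (power_series_derive _ _ _ hh) as [h' [ph' dh]].
  intros z hz. replace (L z) with (h' z); [apply dh, hz|].
  apply (Cseries_unique (fun n => b n * z ^ n)%C); [|apply hb, hz].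
  apply (Cseries_ext (fun n => derived_coef a n * z ^ n)%C); [|apply ph', hz].
  intros n. f_equal. unfold derived_coef, a. field. apply nz.
- intros [|k]; [reflexivity|].
  replace (2 * S k)%nat with (S (2 * k + 1)) by lia. unfold a. rewrite odd. unfold Cdiv. ring.
Qed.

(** The partial sums of the odd terms are the partial sums of odd index of the
    whole series. *)
Lemma odd_part_series (a : nat -> C) (z l : C) :
  (forall k, a (2 * k)%nat = 0) -> Cseries (fun n => a n * z ^ n)%C l ->
  Cseries (fun k => a (2 * k + 1)%nat * z ^ (2 * k + 1)%nat)%C l.
Proof.
intros ev h.
assert (S2 : forall k, Csum_n (fun n => a n * z ^ n)%C (2 * k + 1)%nat =
   Csum_n (fun k => a (2 * k + 1)%nat * z ^ (2 * k + 1)%nat)%C k).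
{ induction k as [|k IH].
  - assert (e0 : a O = 0) by exact (ev O).
    change (2 * 0 + 1)%nat with 1%nat. rewrite sum_Sn, !sum_O, e0.
    change (2 * 0 + 1)%nat with 1%nat. change (plus ?x ?y) with (Cplus x y). simpl. ring.
  - replace (2 * S k + 1)%nat with (S (S (2 * k + 1))) by lia.
    rewrite !sum_Sn, IH. 
    replace (S (2 * k + 1)) with (2 * (S k))%nat by lia. rewrite (ev (S k)).
    replace (S (2 * S k)) with (2 * S k + 1)%nat by lia.
    repeat change (plus ?x ?y) with (Cplus x y).
    match goal with |- @eq _ ?x ?y => change (@eq C x y) end. ring. }
apply (filterlim_ext (fun k => Csum_n (fun n => a n * z ^ n)%C (2 * k + 1)%nat)); [exact S2|].
refine (filterlim_comp _ _ _ (fun k => (2 * k + 1)%nat) _ _ _ _ _ h).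
apply eventually_subseq. intros n. lia.
Qed.

(** Differentiating [g z * g (- z) = c] shows that [g' / g] is even.  With [h]
    its odd primitive, [g * exp (- h)] has derivative zero along rays.  The
    relation also supplies the nonvanishing of [g]. *)
Lemma exp_odd_representation (g : C -> C) (c : C) :
  C1_disk g -> c <> 0 -> (forall z, disk z -> (g z * g (- z))%C = c) ->
  exists a : nat -> C, forall z, disk z -> exists s,
    Cseries (fun k => a (2 * k + 1)%nat * z ^ (2 * k + 1)%nat)%C s /\ g z = (g 0 * Cexp s)%C.
Proof.
intros hg nc e.
assert (nz : forall z, disk z -> g z <> 0).
{ intros z hz h. apply nc. rewrite <- (e z hz), h. ring. }
destruct (C1_power_series _ hg) as [ga hga].
destruct (power_series_derive _ _ _ hga) as [g' [pg' dg]].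
assert (hL : C1_disk (fun z => g' z / g z)%C) by (apply C1_div; [eapply power_series_C1, pg'|exact hg|exact nz]).
destruct (C1_power_series _ hL) as [b hb].
destruct (even_antiderivative b _ hb) as [a [h [ph [dh [a0 ev]]]]].
{ intros z hz. assert (hz' := disk_opp z hz).
  assert (n1 := nz z hz). assert (n2 := nz _ hz').
  assert (D : Cderiv (fun w => g w * g (- w))%C z (g' z * g (- z)%C + g z * (g' (- z)%C * (-1)))%C).
  { apply (Cderiv_mult g (fun w => g (- w)%C)); [apply dg, hz|].
    apply (Cderiv_comp g (fun w => - w)%C); [apply dg, hz'|].
    apply (Cderiv_ext_loc (fun w => 0 + w * (-1))%C); [|apply Cderiv_affine].
    apply near_all. intros w. ring. }
  assert (D0 : Cderiv (fun w => g w * g (- w))%C z 0).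
  { apply (Cderiv_ext_loc (fun _ => c)); [|apply Cderiv_const].
    generalize (near_disk z hz). apply filter_imp. intros w hw. symmetry. apply e, hw. }
  assert (E := Cderiv_unique _ _ _ _ D D0).
  assert (E' : (g' (- z)%C * g z = g' z * g (- z)%C)%C).
  { replace (g' z * g (- z)%C)%C with (g' z * g (- z)%C + g z * (g' (- z)%C * (-1)) + g' (- z)%C * g z)%C by ring.
    rewrite E. ring. }
  transitivity (g' (- z)%C * g z / (g (- z)%C * g z))%C; [field; split; assumption|].
  rewrite E'. field. split; assumption. }
exists a. intros z hz. exists (h z). split; [apply odd_part_series; [exact ev|apply ph, hz]|].
assert (h0 : h 0 = 0).
{ transitivity (a O); [|exact a0]. apply (Cseries_unique (fun n => a n * 0 ^ n)%C); [apply ph, disk_0|apply Cseries_at_0]. }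
assert (K : (g z * Cexp (- h z))%C = g 0).
{ assert (k := curve_deriv_zero_const (fun s => g (RtoC s * z) * Cexp (- h (RtoC s * z)%C))%C).
  cbv beta in k. replace (0 * z)%C with (RtoC 0) in k by ring.
  replace (1 * z)%C with z in k by ring. rewrite h0 in k.
  replace (- (0))%C with (RtoC 0) in k by ring. rewrite Cexp_0 in k.
  rewrite <- k; [ring|].
  intros t ht. assert (dt := ray_disk t z ht hz). assert (nt := nz _ dt).
  assert (A := curve_deriv_ray g _ z t (dg _ dt)).
  assert (B := curve_deriv_ray h _ z t (dh _ dt)).
  assert (B' := curve_deriv_comp (fun w => 0 + w * (-1))%C (fun s => h (RtoC s * z)%C) _ _ _ (Cderiv_affine 0 (-1) _) B).
  assert (E := curve_deriv_mult _ _ _ _ _ A (curve_deriv_Cexp _ _ _ B')). cbv beta in E.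
  replace (0 + h (RtoC t * z)%C * (-1))%C with (- h (RtoC t * z)%C)%C in E by ring.
  match type of E with curve_deriv _ _ ?x => replace x with (RtoC 0) in E by (field; exact nt) end.
  destruct E as [E1 E2]. split; [revert E1|revert E2]; apply (is_derive_ext (V := R_NormedModule));
  intros s; replace (0 + h (RtoC s * z)%C * (-1))%C with (- h (RtoC s * z)%C)%C by ring; reflexivity. }
rewrite <- K. transitivity (g z * (Cexp (- h z) * Cexp (h z)))%C; [|ring].
rewrite Cexp_opp. ring.
Qed.

(** * Involutions of the disk *)

(** The point [p] is the hyperbolic midpoint of [0] and [w], the solution of
    modulus less than 1 of [w = 2 p / (1 + |p|^2)]. *)
Lemma alpha_half w : disk w ->
  exists p, disk p /\ forall z, disk z -> alpha p (- alpha p z)%C = alpha w z.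
Proof.
intros hw. apply disk_sqr in hw.
set (S := Re w * Re w + Im w * Im w) in *.
assert (S0 : 0 <= S) by (unfold S; nra).
set (q := sqrt (1 - S)).
assert (q0 : 0 < q) by (apply sqrt_lt_R0; lra).
assert (qq : q * q = 1 - S) by (apply sqrt_sqrt; lra).
set (p := (w / RtoC (1 + q))%C).
assert (nq : RtoC (1 + q) <> 0) by (intros e; apply RtoC_inj in e; lra).
assert (ew : w = (p * RtoC (1 + q))%C) by (unfold p; field; exact nq).
assert (ww : (Cconj w * w)%C = RtoC S).
{ apply C_ext; unfold S, Re, Im; simpl; ring. }
assert (pp : (Cconj p * p * RtoC ((1 + q) * (1 + q)))%C = RtoC ((1 - q) * (1 + q))).
{ replace ((1 - q) * (1 + q)) with S by lra. rewrite <- ww, ew, Cmult_conj.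
  rewrite RtoC_mult. replace (Cconj (RtoC (1 + q))) with (RtoC (1 + q)).
  ring. apply C_ext; simpl; ring. }
assert (pp' : (Cconj p * p * RtoC (1 + q))%C = RtoC (1 - q)).
{ rewrite !RtoC_mult in pp.
  transitivity (Cconj p * p * (RtoC (1 + q) * RtoC (1 + q)) / RtoC (1 + q))%C.
  - field. exact nq.
  - rewrite pp. field. exact nq. }
assert (hp : disk p).
{ unfold disk, p. rewrite Cmod_div by exact nq. rewrite Cmod_R, Rabs_pos_eq by lra.
  assert (c : Cmod w < 1) by (apply disk_sqr; exact hw).
  apply Rlt_div_l; lra. }
exists p. split; [exact hp|]. intros z hz.
assert (hz' := alpha_disk p z hp hz).
assert (d1 := alpha_den p z hp hz).
assert (d2 := alpha_den p _ hp (disk_opp _ hz')).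
assert (d3 := alpha_den w z ltac:(apply disk_sqr; exact hw) hz).
assert (X : (1 - Cconj p * - alpha p z)%C = (((1 + Cconj p * p) - 2 * Cconj p * z) / (1 - Cconj p * z))%C).
{ unfold alpha. field. exact d1. }
assert (d4 : ((1 + Cconj p * p) - 2 * Cconj p * z)%C <> 0).
{ intros e. apply d2. rewrite X, e. unfold Cdiv. ring. }
unfold alpha at 1. rewrite X.
transitivity ((2 * p - (1 + Cconj p * p) * z) / (1 + Cconj p * p - 2 * Cconj p * z))%C.
{ unfold alpha. field. split; [exact d4|exact d1]. }
assert (e2 : ((1 + Cconj p * p) * RtoC (1 + q))%C = 2).
{ replace ((1 + Cconj p * p) * RtoC (1 + q))%C with (RtoC (1 + q) + Cconj p * p * RtoC (1 + q))%C by ring.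
  rewrite pp', <- RtoC_plus. f_equal. ring. }
assert (cw : Cconj w = (Cconj p * RtoC (1 + q))%C).
{ rewrite ew, Cmult_conj. f_equal. apply C_ext; simpl; ring. }
assert (n2 : RtoC 2 <> 0) by (intros e; apply RtoC_inj in e; lra).
assert (ep : (1 + Cconj p * p)%C = (2 / RtoC (1 + q))%C).
{ rewrite <- e2. field. exact nq. }
unfold alpha. rewrite cw in *. rewrite ep in *. rewrite ew.
field. split; [exact d3|split; [exact nq|]].
intros e. apply (Cmult_neq_0 _ _ nq d4). rewrite <- e. field. exact nq.
Qed.

(** With [w = phi 0], the maps [alpha w o phi] and [phi o alpha w] are inverse
    to each other and fix the centre, so [phi z = alpha w (lam z)].  If
    [w <> 0], then [phi w = 0] gives [lam = 1]; if [w = 0], then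
    [phi z = - lam z] and [lam^2 = 1]. *)
Lemma involution_form phi :
  C1_disk phi -> (forall z, disk z -> disk (phi z)) ->
  (forall z, disk z -> phi (phi z) = z) ->
  eq_on_disk phi (fun z => z) \/
  exists p, disk p /\ eq_on_disk phi (fun z => alpha p (- alpha p z)%C).
Proof.
intros hphi self inv. set (w := phi 0). assert (hw : disk w) by apply self, disk_0.
destruct (schwarz_automorphism (fun z => alpha w (phi z)) (fun z => phi (alpha w z)))
  as [lam hlam].
- apply C1_comp; [apply alpha_C1, hw|exact hphi|exact self].
- apply C1_comp; [exact hphi|apply alpha_C1, hw|]. intros z. apply alpha_disk, hw.
- intros z hz. apply alpha_disk; [exact hw|apply self, hz].
- intros z hz. apply self, alpha_disk; assumption.
- apply alpha_self.
- rewrite alpha_at_0. apply inv, disk_0.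
- intros z hz. rewrite (alpha_involutive w (phi z) hw (self z hz)). apply inv, hz.
- cbv beta in hlam.
  assert (form : forall z, disk z -> phi z = alpha w (lam * z)%C).
  { intros z hz. rewrite <- hlam by exact hz. symmetry. apply (alpha_involutive w (phi z) hw (self z hz)). }
  assert (half : (forall z, disk z -> (lam * z)%C = z) -> 
     exists p, disk p /\ eq_on_disk phi (fun z => alpha p (- alpha p z)%C)).
  { intros l1. destruct (alpha_half w hw) as [p [hp ep]]. exists p. split; [exact hp|].
    intros z hz. rewrite (ep z hz), (form z hz), (l1 z hz). reflexivity. }
  destruct (Ceq_dec w 0) as [w0|nw].
  + assert (form0 : forall z, disk z -> phi z = (- (lam * z))%C).
    { intros z hz. rewrite form, w0 by exact hz. unfold alpha.
      replace (1 - Cconj 0 * (lam * z))%C with (RtoC 1).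
      - field.
      - replace (Cconj 0) with (RtoC 0) by (apply C_ext; simpl; ring). ring. }
    assert (h2 : disk (RtoC (1 / 2))) by (unfold disk; rewrite Cmod_R, Rabs_pos_eq; lra).
    assert (n2 : RtoC (1 / 2) <> 0) by (intros e; apply RtoC_inj in e; lra).
    assert (l2 : ((lam - 1) * (lam + 1))%C = 0).
    { assert (e := inv _ h2). rewrite (form0 _ (self _ h2)), (form0 _ h2) in e.
      transitivity ((- (lam * (- (lam * RtoC (1 / 2)))) - RtoC (1 / 2)) / RtoC (1 / 2))%C.
      - field. exact n2.
      - rewrite e. field. exact n2. }
    destruct (Ceq_dec (lam - 1)%C 0) as [e1|n1].
    * right. apply half. intros z hz. apply Ceq_minus in e1. rewrite e1. ring.
    * left. assert (e1 : (lam + 1)%C = 0).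
      { apply NNPP. intros n. exact (Cmult_neq_0 _ _ n1 n l2). }
      intros z hz. rewrite form0 by exact hz.
      replace lam with (lam + 1 - 1)%C by ring. rewrite e1. ring.
  + right. apply half. intros z hz.
    assert (e : alpha w (phi w) = (lam * w)%C) by (apply hlam, hw).
    assert (e0 : phi w = 0) by (apply inv, disk_0).
    rewrite e0, alpha_at_0 in e.
    transitivity (lam * w / w * z)%C; [field; exact nw|]. rewrite <- e. field. exact nw.
Qed.

(** * Functions in the Hardy space *)

Lemma in_H2_C1 f : in_H2 f -> C1_disk f.
Proof.
intros [a [h _]]. apply (power_series_C1 a). intros z hz. apply is_pseries_Cseries, h, hz.
Qed.

Lemma quadratic_in_H2 k0 k1 k2 : in_H2 (fun z => k0 + k1 * z + k2 * (z * z))%C.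
Proof.
exists (fun n => match n with O => k0 | 1%nat => k1 | 2%nat => k2 | _ => RtoC 0 end).
split.
- intros z _. apply is_pseries_Cseries.
  do 3 (apply Cseries_cons). apply (Cseries_ext (fun _ => RtoC 0)); [intros n; simpl; ring|].
  match goal with |- is_series _ ?x => replace x with (RtoC 0) by (simpl; ring) end.
  apply Cseries_zero.
- do 3 (apply ex_series_incr_1). apply (ex_series_ext (fun _ => 0)).
  + intros n. rewrite Cmod_0. to_R_eq. ring.
  + exists 0. apply filterlim_ext with (fun _ : nat => 0); [|apply filterlim_const].
    intros n. rewrite sum_n_const. ring.
Qed.

(** * Quadratic relations between symbol and weight *)

Lemma zero_on_image phi F z0 :
  C1_disk F -> disk z0 -> disk (phi z0) -> Ccont_at phi z0 ->
  near z0 (fun z => F (phi z) = 0) ->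
  eq_on_disk F (fun _ => RtoC 0) \/ near z0 (fun z => phi z = phi z0).
Proof.
intros hF dz dp cp h.
destruct (zero_isolated F (phi z0) hF dp (near_self _ _ h)) as [e|e]; [left; exact e|right].
generalize (filter_and _ _ h (Ccont_at_near _ _ _ cp e)). apply filter_imp.
intros z [e0 n]. apply NNPP. intros ne. exact (n ne e0).
Qed.

(** The functions [psi] and [psi * phi], unlike [phi], are known to be power
    series: the identity principle applies to [psi * phi - phi z0 * psi], and
    the zeros of [psi] are filled in by continuity of [phi]. *)
Lemma constant_from_germ phi psi z0 :
  (forall z, disk z -> Ccont_at phi z) -> C1_disk psi -> C1_disk (fun z => psi z * phi z)%C ->
  disk z0 -> ~ eq_on_disk psi (fun _ => RtoC 0) -> near z0 (fun z => phi z = phi z0) ->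
  eq_on_disk phi (fun _ => phi z0).
Proof.
intros cphi hpsi hpp dz0 nz h.
assert (hF : C1_disk (fun z => psi z * phi z - phi z0 * psi z)%C).
{ apply C1_minus; [exact hpp|]. apply C1_mult; [apply C1_const|exact hpsi]. }
assert (F0 : eq_on_disk (fun z => psi z * phi z - phi z0 * psi z)%C (fun _ => RtoC 0)).
{ apply (identity_principle _ z0 hF dz0).
  revert h. apply filter_imp. intros z e. rewrite e. ring. }
assert (K : forall z, disk z -> psi z <> 0 -> phi z = phi z0).
{ intros z dz n. specialize (F0 z dz). cbv beta in F0.
  replace (phi z) with (phi z0 + (psi z * phi z - phi z0 * psi z) / psi z)%C by (field; exact n).
  rewrite F0. field. exact n. }
intros z dz. destruct (Ceq_dec (psi z) 0) as [e|n]; [|apply K; assumption].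
destruct (zero_isolated psi z hpsi dz e) as [e'|e']; [contradiction|].
apply (Ccont_at_eq_punctured phi (fun _ => phi z0)); [apply cphi, dz|apply Ccont_const|].
generalize (filter_and _ _ (near_disk z dz) e'). apply filter_imp.
intros y [dy hy] ny. apply K; auto.
Qed.

Lemma Cmult_eq_0 (x y : C) : (x * y)%C = 0 -> x = 0 \/ y = 0.
Proof.
intros e. destruct (Ceq_dec x 0) as [h|h]; [left; exact h|right].
apply NNPP. intros n. exact (Cmult_neq_0 _ _ h n e).
Qed.

(** With [v = psi 0] the relation factors as
    [(psi - v) (c2 (psi + v) + c1) = 0], and there are no zero divisors. *)
Lemma quadratic_relation_const psi (c0 c1 c2 : C) :
  C1_disk psi -> c2 <> 0 ->
  (forall z, disk z -> (c0 + c1 * psi z + c2 * (psi z * psi z))%C = 0) ->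
  exists w, eq_on_disk psi (fun _ => w).
Proof.
intros h n2 e. set (v := psi 0).
destruct (C1_integral (fun z => psi z - v)%C (fun z => c2 * (psi z + v) + c1)%C) as [A|A].
- apply C1_minus; [exact h|apply C1_const].
- apply C1_plus; [|apply C1_const]. apply C1_mult; [apply C1_const|].
  apply C1_plus; [exact h|apply C1_const].
- intros z hz. 
  transitivity ((c0 + c1 * psi z + c2 * (psi z * psi z)) - (c0 + c1 * v + c2 * (v * v)))%C; [ring|].
  rewrite (e z hz). unfold v. rewrite (e 0 disk_0). ring.
- exists v. intros z hz. apply Ceq_minus. apply A, hz.
- exists (- c1 / c2 - v)%C. intros z hz. specialize (A z hz). cbv beta in A.
  replace (psi z) with ((c2 * (psi z + v) + c1) / c2 - c1 / c2 - v)%C by (field; exact n2).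
  rewrite A. field. exact n2.
Qed.

Section Relation.
Variables (phi psi : C -> C) (c0 c1 c2 : C).
Hypothesis phi_cont : forall z, disk z -> Ccont_at phi z.
Hypothesis phi_self : forall z, disk z -> disk (phi z).
Hypothesis psi_C1 : C1_disk psi.
Hypothesis prod_C1 : C1_disk (fun z => psi z * phi z)%C.
Hypothesis psi_nz : ~ eq_on_disk psi (fun _ => RtoC 0).
Hypothesis c_nz : ~ (c0 = 0 /\ c1 = 0 /\ c2 = 0).
(* The relation [c0 + c1 W + c2 W^2 = 0], evaluated at [z] on polynomials of
   degree at most 2. *)
Hypothesis rel : forall k0 k1 k2 z, disk z ->
  let f := (fun w => k0 + k1 * w + k2 * (w * w))%C in
  (c0 * f z + c1 * (psi z * f (phi z)) + c2 * (psi z * (psi (phi z) * f (phi (phi z)))))%C = 0.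

Definition is_const (f : C -> C) : Prop := exists w, eq_on_disk f (fun _ => w).

Lemma rel_1 z : disk z -> (c0 + c1 * psi z + c2 * (psi z * psi (phi z)))%C = 0.
Proof. intros hz. rewrite <- (rel 1 0 0 z hz). ring. Qed.

Lemma rel_id z : disk z ->
  (c0 * z + c1 * (psi z * phi z) + c2 * (psi z * (psi (phi z) * phi (phi z))))%C = 0.
Proof. intros hz. rewrite <- (rel 0 1 0 z hz). ring. Qed.

Lemma rel_two u v z : disk z ->
  (c0 * ((z - u) * (z - v)) + c1 * (psi z * ((phi z - u) * (phi z - v)))
    + c2 * (psi z * (psi (phi z) * ((phi (phi z) - u) * (phi (phi z) - v)))))%C = 0.
Proof. intros hz. rewrite <- (rel (u * v) (- (u + v)) 1 z hz). ring. Qed.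

Lemma psi_nz_point : exists z0, disk z0 /\ psi z0 <> 0.
Proof.
apply not_all_ex_not in psi_nz. destruct psi_nz as [z h]. apply imply_to_and in h.
exists z. exact h.
Qed.

Lemma phi_C1 : (forall z, disk z -> psi z <> 0) -> C1_disk phi.
Proof.
intros n. apply (C1_ext (fun z => psi z * phi z / psi z)%C).
- intros z hz. field. apply n, hz.
- apply C1_div; assumption.
Qed.

(** Near a point where [psi] does not vanish, [phi] takes its values in the zero
    set of [F].  If [F] is not zero this set is discrete, so [phi] is locally
    constant. *)
Lemma zero_or_const F :
  C1_disk F -> (forall z, disk z -> psi z <> 0 -> F (phi z) = 0) ->
  eq_on_disk F (fun _ => RtoC 0) \/ is_const phi.
Proof.
intros hF h. destruct psi_nz_point as [z0 [dz nz]].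
destruct (zero_on_image phi F z0 hF dz (phi_self _ dz) (phi_cont _ dz)) as [e|e].
- generalize (filter_and _ _ (near_disk _ dz) (Ccont_at_neq0 _ _ (C1_cont _ _ psi_C1 dz) nz)).
  apply filter_imp. intros z [a b]. apply h; assumption.
- left. exact e.
- right. exists (phi z0). apply (constant_from_germ phi psi); assumption.
Qed.

(** Evaluating the relation on 1 and dividing by [psi] shows that
    [c1 + c2 psi] vanishes on the image under [phi] of the points where [psi]
    does not vanish.  If [phi] is not constant, then [psi] is the constant
    [- c1 / c2], so that [c1 <> 0], and the relation on the identity becomes
    [phi (phi z) = phi z]. *)
Lemma relation_degenerate : c0 = 0 -> c2 <> 0 ->
  is_const phi \/ (eq_on_disk phi (fun z => z) /\ is_const psi).
Proof.
intros e0 n2. destruct (Ceq_dec c1 0) as [e1|n1].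
- left. destruct (zero_or_const psi psi_C1) as [e|e]; [|contradiction|exact e].
  intros z hz nz. assert (r := rel_1 z hz). rewrite e0, e1 in r.
  replace (psi (phi z)) with ((0 + 0 * psi z + c2 * (psi z * psi (phi z))) / (c2 * psi z))%C
    by (field; split; assumption).
  rewrite r. field. split; assumption.
- destruct (zero_or_const (fun z => psi z + c1 / c2)%C) as [e|e].
  + apply C1_plus; [exact psi_C1|apply C1_const].
  + intros z hz nz. assert (r := rel_1 z hz). rewrite e0 in r.
    replace (psi (phi z) + c1 / c2)%C with ((0 + c1 * psi z + c2 * (psi z * psi (phi z))) / (c2 * psi z))%C
      by (field; split; assumption).
    rewrite r. field. split; assumption.
  + assert (k : forall z, disk z -> psi z = (- c1 / c2)%C).
    { intros z hz. replace (psi z) with (psi z + c1 / c2 - c1 / c2)%C by ring.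
      rewrite (e z hz). field. exact n2. }
    assert (nz : forall z, disk z -> psi z <> 0).
    { intros z hz h. rewrite k in h by exact hz. apply n1.
      replace c1 with (- (- c1 / c2) * c2)%C by (field; exact n2). rewrite h. ring. }
    destruct (zero_or_const (fun z => phi z - z)%C) as [e'|e'].
    * apply C1_minus; [apply phi_C1, nz|apply C1_id].
    * intros z hz _. assert (r := rel_id z hz).
      rewrite e0, (k _ hz), (k _ (phi_self _ hz)) in r.
      replace (phi (phi z) - phi z)%C with
        ((0 * z + c1 * (- c1 / c2 * phi z) + c2 * (- c1 / c2 * (- c1 / c2 * phi (phi z)))) * c2 / (c1 * c1))%C
        by (field; split; assumption).
      rewrite r. field. exact n1.
    * right. split.
      { intros z hz. apply Ceq_minus. apply e', hz. }
      { exists (- c1 / c2)%C. exact k. }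
    * left. exact e'.
  + left. exact e.
Qed.

Lemma relation_linear : c2 = 0 -> eq_on_disk phi (fun z => z) /\ is_const psi.
Proof.
intros e2.
assert (n1 : c1 <> 0).
{ intros e1. apply c_nz. split; [|split; assumption].
  assert (r := rel_1 0 disk_0). rewrite e1, e2 in r. rewrite <- r. ring. }
assert (k : forall z, disk z -> psi z = (- c0 / c1)%C).
{ intros z hz. assert (r := rel_1 z hz). rewrite e2 in r.
  replace (psi z) with ((c0 + c1 * psi z + 0 * (psi z * psi (phi z))) / c1 - c0 / c1)%C
    by (field; exact n1).
  rewrite r. field. exact n1. }
split; [|exists (- c0 / c1)%C; exact k].
destruct psi_nz_point as [z0 [dz0 nz0]]. rewrite (k _ dz0) in nz0.
assert (n0 : c0 <> 0).
{ intros e. apply nz0. rewrite e. field. exact n1. }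
intros z hz. assert (r := rel_id z hz). rewrite e2, (k z hz) in r.
apply Ceq_minus.
replace (phi z - z)%C with
 (- (c0 * z + c1 * (- c0 / c1 * phi z) + 0 * (- c0 / c1 * (psi (phi z) * phi (phi z)))) / c0)%C
 by (field; split; assumption).
rewrite r. field. exact n0.
Qed.

(** If [z] differed from [phi z] and from [phi (phi z)], the polynomial with
    the latter two as zeros would contradict [c0 <> 0]; and [z = phi z] implies
    [z = phi (phi z)] anyway.  Comparing the relations on 1 and on the identity
    then leaves [c1 psi (phi - id) = 0]. *)
Lemma relation_invertible : c0 <> 0 -> c2 <> 0 ->
  (forall z, disk z -> phi (phi z) = z) /\ (forall z, disk z -> psi z <> 0) /\
  (eq_on_disk phi (fun z => z) \/ c1 = 0).
Proof.
intros n0 n2.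
assert (inv : forall z, disk z -> phi (phi z) = z).
{ intros z hz. assert (r := rel_two (phi z) (phi (phi z)) z hz).
  assert (r' : (c0 * ((z - phi z) * (z - phi (phi z))))%C = 0).
  { rewrite <- r. ring. }
  apply Cmult_eq_0 in r'. destruct r' as [|r']; [contradiction|].
  apply Cmult_eq_0 in r'. destruct r' as [r'|r']; apply Ceq_minus in r'.
  - rewrite <- r'. symmetry. exact r'.
  - symmetry. exact r'. }
assert (nz : forall z, disk z -> psi z <> 0).
{ intros z hz e. assert (r := rel_1 z hz). rewrite e in r. apply n0. rewrite <- r. ring. }
split; [exact inv|split; [exact nz|]].
destruct (Ceq_dec c1 0) as [e1|n1]; [right; exact e1|left].
intros z hz. assert (r1 := rel_1 z hz). assert (r2 := rel_id z hz). rewrite (inv z hz) in r2.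
assert (r : (c1 * (psi z * (phi z - z)))%C = 0).
{ transitivity ((c0 * z + c1 * (psi z * phi z) + c2 * (psi z * (psi (phi z) * z)))
   - z * (c0 + c1 * psi z + c2 * (psi z * psi (phi z))))%C; [ring|].
  rewrite r1, r2. ring. }
apply Cmult_eq_0 in r. destruct r as [|r]; [contradiction|].
apply Cmult_eq_0 in r. destruct r as [r|r]; [exfalso; exact (nz z hz r)|].
apply Ceq_minus. exact r.
Qed.

Lemma relation_classification :
  is_const phi \/ (eq_on_disk phi (fun z => z) /\ is_const psi) \/
  (exists p : C, disk p /\
      eq_on_disk phi (fun z => alpha p (- alpha p z)%C) /\
      exists (c : C) (a : nat -> C),
        forall z : C, disk z ->
          exists s : C,
            Cseries (fun k : nat => (a (2 * k + 1)%nat * z ^ (2 * k + 1)%nat)%C) s /\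
            psi (alpha p z) = (c * Cexp s)%C).
Proof.
destruct (Ceq_dec c2 0) as [e2|n2]; [right; left; apply relation_linear, e2|].
destruct (Ceq_dec c0 0) as [e0|n0].
{ destruct (relation_degenerate e0 n2) as [h|h]; [left|right; left]; exact h. }
destruct (relation_invertible n0 n2) as [inv [nz d]]. right.
destruct (involution_form phi (phi_C1 nz) phi_self inv) as [i|[p [hp e]]].
{ left. split; [exact i|]. apply (quadratic_relation_const psi c0 c1 c2 psi_C1 n2).
  intros z hz. rewrite <- (rel_1 z hz). rewrite (i z hz). reflexivity. }
destruct d as [i|e1].
{ left. split; [exact i|]. apply (quadratic_relation_const psi c0 c1 c2 psi_C1 n2).
  intros z hz. rewrite <- (rel_1 z hz). rewrite (i z hz). reflexivity. }
right. exists p. split; [exact hp|split; [exact e|]].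
destruct (exp_odd_representation (fun z => psi (alpha p z)) (- c0 / c2)%C) as [a ha].
- apply C1_comp; [exact psi_C1|apply alpha_C1, hp|]. intros z. apply alpha_disk, hp.
- intros h. apply n0. replace c0 with (- (- c0 / c2) * c2)%C by (field; exact n2).
  rewrite h. ring.
- intros z hz. assert (da := alpha_disk p z hp hz).
  assert (r := rel_1 _ da). rewrite e1 in r.
  rewrite (e _ da), (alpha_involutive p z hp hz) in r.
  transitivity ((c0 + 0 * psi (alpha p z) + c2 * (psi (alpha p z) * psi (alpha p (- z)))) / c2 - c0 / c2)%C.
  + field. exact n2.
  + rewrite r. field. exact n2.
- exists (psi (alpha p 0)), a. exact ha.
Qed.
End Relation.

(** * Algebraic operators *)

(** The degree exists as the least element of a nonempty set of integers. *)
Lemma annihilated_of_degree_le T d :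
  H2_annihilated_in_degree T d -> (d <= 2)%nat ->
  exists n, (n <= 2)%nat /\ H2_algebraic_of_degree T n.
Proof.
intros h hd.
destruct (dec_inh_nat_subset_has_unique_least_element (H2_annihilated_in_degree T)
  (fun n => classic _) (ex_intro _ d h)) as [n [[hn least] _]].
exists n. split; [|split; [exact hn|exact least]].
apply Nat.le_trans with d; [apply least, h|exact hd].
Qed.

Lemma annihilated_by_monic_quadratic T (c0 c1 : C) :
  (forall f, in_H2 f -> forall z, disk z -> (c0 * f z + c1 * T f z + T (T f) z)%C = 0) ->
  H2_annihilated_in_degree T 2.
Proof.
intros h. exists (fun n => match n with O => c0 | 1%nat => c1 | _ => RtoC 1 end).
split; [exact C1_nz|]. intros f hf z hz.
rewrite !sum_Sn, sum_O. repeat change (plus ?x ?y) with (Cplus x y). simpl.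
rewrite <- (h f hf z hz). ring.
Qed.

Lemma quadratic_relation_of_annihilated T d :
  (d <= 2)%nat -> H2_annihilated_in_degree T d ->
  exists c0 c1 c2 : C, ~ (c0 = 0 /\ c1 = 0 /\ c2 = 0) /\
   forall f, in_H2 f -> forall z, disk z -> (c0 * f z + c1 * T f z + c2 * T (T f) z)%C = 0.
Proof.
intros hd [c [nz h]].
exists (c 0%nat), (if le_dec 1 d then c 1%nat else RtoC 0), (if le_dec 2 d then c 2%nat else RtoC 0).
assert (D : d = 0%nat \/ d = 1%nat \/ d = 2%nat) by lia.
destruct D as [->|[->| ->]]; destruct (le_dec 1 _) as [H1|H1]; try lia;
destruct (le_dec 2 _) as [H2|H2]; try lia; clear H1 H2; split.
- intros [e _]. contradiction.
- intros f hf z hz. etransitivity; [|apply (h f hf z hz)]. cbv beta. rewrite sum_O. simpl. ring.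
- intros [_ [e _]]. contradiction.
- intros f hf z hz. etransitivity; [|apply (h f hf z hz)]. cbv beta. rewrite sum_Sn, sum_O.
  repeat change (plus ?x ?y) with (Cplus x y). simpl. ring.
- intros [_ [_ e]]. contradiction.
- intros f hf z hz. etransitivity; [|apply (h f hf z hz)]. cbv beta. rewrite !sum_Sn, sum_O.
  repeat change (plus ?x ?y) with (Cplus x y). simpl. ring.
Qed.

Lemma ex_derive_ccont f z : @ex_derive C_AbsRing C_NormedModule f z -> Ccont_at f z.
Proof.
intros h. apply Ccont_continuous. intros P hP.
assert (k := ex_derive_continuous f z h P hP). apply locally_C. exact k.
Qed.

Theorem theorem6 (phi psi : C -> C)
  (phi_holo : holomorphic_on_disk phi)
  (phi_self : forall z : C, disk z -> disk (phi z))
  (psi_holo : holomorphic_on_disk psi)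
  (psi_nz : ~ eq_on_disk psi (fun _ => RtoC 0))
  (W_bounded : H2_bounded_operator (weighted_comp psi phi)) :
  (exists n : nat,
     (n <= 2)%nat /\ H2_algebraic_of_degree (weighted_comp psi phi) n)
  <->
  ((exists w : C, eq_on_disk phi (fun _ => w))
   \/
   (eq_on_disk phi (fun z => z) /\ exists w : C, eq_on_disk psi (fun _ => w))
   \/
   (exists p : C, disk p /\
      eq_on_disk phi (fun z => alpha p (- alpha p z)%C) /\
      exists (c : C) (a : nat -> C),
        forall z : C, disk z ->
          exists s : C,
            @is_series C_AbsRing C_NormedModule
              (fun k : nat => (a (2 * k + 1)%nat * z ^ (2 * k + 1)%nat)%C) s /\
            psi (alpha p z) = (c * Cexp s)%C)).
Proof.
split.
- intros [d [hd [ann _]]].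
  destruct (quadratic_relation_of_annihilated _ d hd ann) as [c0 [c1 [c2 [nz rel]]]].
  destruct W_bounded as [_ [WH _]].
  assert (H1 : C1_disk psi).
  { apply (C1_ext (weighted_comp psi phi (fun z => 1 + 0 * z + 0 * (z * z))%C)).
    - intros z _. unfold weighted_comp. ring.
    - apply in_H2_C1, WH, quadratic_in_H2. }
  assert (H2 : C1_disk (fun z => psi z * phi z)%C).
  { apply (C1_ext (weighted_comp psi phi (fun z => 0 + 1 * z + 0 * (z * z))%C)).
    - intros z _. unfold weighted_comp. ring.
    - apply in_H2_C1, WH, quadratic_in_H2. }
  apply (relation_classification phi psi c0 c1 c2); try assumption.
  + intros z hz. apply ex_derive_ccont, phi_holo, hz.
  + intros k0 k1 k2 z hz. apply (rel _ (quadratic_in_H2 k0 k1 k2) z hz).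
- intros [[w ew]|[[ei [w ew]]|[p [hp [ep [c [a hs]]]]]]].
  + assert (hw : disk w) by (rewrite <- (ew 0 disk_0); apply phi_self, disk_0).
    apply (annihilated_of_degree_le _ 2); [|apply Nat.le_refl].
    apply (annihilated_by_monic_quadratic _ 0 (- psi w)%C).
    intros f _ z hz. unfold weighted_comp. rewrite (ew z hz), (ew w hw). ring.
  + apply (annihilated_of_degree_le _ 2); [|apply Nat.le_refl].
    apply (annihilated_by_monic_quadratic _ 0 (- w)%C).
    intros f _ z hz. unfold weighted_comp. rewrite (ei z hz), (ei z hz), (ew z hz). ring.
  + apply (annihilated_of_degree_le _ 2); [|apply Nat.le_refl].
    apply (annihilated_by_monic_quadratic _ (- (c * c))%C 0).
    intros f _ z hz. unfold weighted_comp.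
    set (u := alpha p z). assert (hu : disk u) by (apply alpha_disk; assumption).
    assert (ez : z = alpha p u) by (symmetry; apply alpha_involutive; assumption).
    assert (e1 : phi z = alpha p (- u)%C) by apply (ep z hz).
    assert (e2 : phi (phi z) = z).
    { rewrite (ep _ (phi_self z hz)), e1, (alpha_involutive p _ hp (disk_opp u hu)), ez.
      f_equal. ring. }
    destruct (hs u hu) as [s [ss es]]. destruct (hs _ (disk_opp u hu)) as [s' [ss' es']].
    assert (s's : s' = (- s)%C).
    { apply (Cseries_unique _ _ _ ss'). replace (- s)%C with (- (1) * s)%C by ring.
      apply (Cseries_ext (fun k => - (1) * (a (2 * k + 1)%nat * u ^ (2 * k + 1)%nat))%C).
      - intros k. replace (- u)%C with (- (1) * u)%C by ring.
        rewrite Cpow_mult_l, (Cpow_add_r (- (1))), Cpow_mult_r, Cpow_1_r.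
        replace ((- (1)) ^ 2)%C with (RtoC 1) by (simpl; ring). rewrite Cpow_1_l. ring.
      - apply Cseries_scal, ss. }
    assert (es0 : psi z = (c * Cexp s)%C)
      by (transitivity (psi (alpha p u)); [f_equal; exact ez|exact es]).
    rewrite e2, e1, es', s's, es0.
    transitivity (- (c * c) * f z + c * c * (Cexp (- s) * Cexp s) * f z)%C; [ring|].
    rewrite Cexp_opp. ring.
Qed.
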